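(* Suppose that $m_1=\sum_{i=1}^\infty i q_i<\infty$. Let $(\mu_t:t\ge 0)$ be the generalized CDR model, that is, a family of Borel probability measures on $\mathbb{R}_+$ such that for every $f\in \mathrm{b}\mathscr{C}^1_*(\mathbb{R}_+)$, $$\partial_t\langle\mu_t,f\rangle = a\langle\mu_t*\mu_t^q-\mu_t,f\rangle-\langle\mu_t,f'1_{(0,\infty)}\rangle,\quad t\ge 0.$$ For each integer $k\ge a$, $k\ge 1$, let $(\mu_n^{(k)}:n\ge 0)$ be a generalized DR model with renewal rate $\alpha=a/k$ and offspring distribution $q$, and let $\gamma_n^{(k)}$ be the probability measure on $\mathbb{R}_+$ given by $\gamma_n^{(k)}(\mathrm{d}x)=\mu_n^{(k)}(k\,\mathrm{d}x)$. If $\gamma_0^{(k)}\to\mu_0$ weakly as $k\to\infty$, then for every $t\ge 0$, $\gamma^{(k)}_{\lfloor kt\rfloor}\to\mu_t$ weakly as $k\to\infty$.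
   Context: $\mathbb{R}_+=[0,\infty)$. $a\ge 0$ is a fixed constant and $q=\{q_1,q_2,\dots\}$ is a fixed probability distribution on $\{1,2,\dots\}$. For a Borel probability measure $\mu$ on $\mathbb{R}_+$, $\mu^q=\sum_{i=1}^\infty q_i\mu^{*i}$, where $\mu^{*i}$ is the $i$-fold convolution of $\mu$. $\langle\gamma,f\rangle=\int_{\mathbb{R}_+}f\,\mathrm{d}\gamma$. $\mathrm{b}\mathscr{C}^1_*(\mathbb{R}_+)$ is the set of bounded continuous functions $f$ on $\mathbb{R}_+$ with bounded continuous first derivative satisfying $f'(0)=0$. For $c\ge0$ let $T_c(x)=(x-c)_+$, and let $\mu\circ T_c^{-1}$ denote the image of $\mu$ under $T_c$. Given $0\le\alpha\le 1$, a generalized DR model with renewal rate $\alpha$ and offspring distribution $q$ is a sequence of Borel probability measures $(\mu_n:n\ge0)$ on $\mathbb{R}_+$ satisfying $\mu_{n+1}=[(1-\alpha)\mu_n+\alpha\,\mu_n*\mu_n^q]\circ T_1^{-1}$ for $n\ge 0$ (the initial distribution $\mu_0$ being arbitrary). The measure $\gamma_n^{(k)}$ is the law of $X/k$ when $X$ has law $\mu_n^{(k)}$. *)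

(* Defs.v *)
From HB Require Import structures.
From mathcomp Require Import all_boot all_order all_algebra.
From mathcomp Require Import all_classical all_reals all_analysis.
From mathcomp Require Import measurable_realfun.

Set Implicit Arguments.
Unset Strict Implicit.
Unset Printing Implicit Defensive.
Import Order.TTheory GRing.Theory Num.Theory.
Import numFieldNormedType.Exports.

Local Open Scope classical_set_scope.
Local Open Scope ring_scope.

Definition Rplus {R : realType} : set R := [set x | 0 <= x].

(* Borel probability measures on R_+ are represented by the Borel probability
   measures on the whole line that give mass one to R_+; functions on R_+ are
   functions on the line of which only the values on R_+ matter, and the
   pairing <gamma, f> only integrates over R_+. *)
Notation probR R := (probability (measurableTypeR R) R).

Definition on_Rplus {R : realType} (mu : probR R) : Prop := mu Rplus = 1%E.

Definition pairing {R : realType} (mu : probR R) (f : R -> R) : R :=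
  \int[mu]_(x in Rplus) f x.

Section convolution.
Context {R : realType}.

Definition add_pair (x : measurableTypeR R * measurableTypeR R)
  : measurableTypeR R := (x.1 : R) + (x.2 : R).

Lemma measurable_add_pair : measurable_fun [set: _] add_pair.
Proof. exact: (@measurable_funD _ _ R setT fst snd). Qed.

HB.instance Definition _ :=
  isMeasurableFun.Build _ _ _ _ add_pair measurable_add_pair.

Definition convolve (mu nu : probR R) : probR R :=
  distribution (mu \x nu)%E add_pair.

Fixpoint conv_pow (mu : probR R) (i : nat) : probR R :=
  if i is j.+1 then convolve mu (conv_pow mu j) else (\d_(0 : measurableTypeR R)).

End convolution.

(* A probability distribution on {1, 2, ...}, as a mass function on nat. *)
Record offspring (R : realType) := Offspring {
  offspring_mass :> nat -> R ;
  offspring_ge0 : forall i, 0 <= offspring_mass i ;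
  offspring_at0 : offspring_mass 0%N = 0 ;
  offspring_sum : (\sum_(1 <= i <oo) (offspring_mass i)%:E = 1)%E }.

Section mixture.
Context {R : realType} (q : offspring R) (mu : probR R).

Definition conv_mix : set (measurableTypeR R) -> \bar R :=
  mseries (fun i => mscale (NngNum (offspring_ge0 q i)) (conv_pow mu i)) 1.

HB.instance Definition _ := Measure.on conv_mix.

Lemma conv_mixE A :
  conv_mix A = (\sum_(1 <= i <oo) (q i)%:E * conv_pow mu i A)%E.
Proof. by []. Qed.

Lemma conv_mix_setT : conv_mix setT = 1%E.
Proof.
rewrite conv_mixE -(offspring_sum q); apply: eq_eseriesr => i _.
by rewrite probability_setT mule1.
Qed.

HB.instance Definition _ :=
  Measure_isProbability.Build _ _ _ conv_mix conv_mix_setT.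

End mixture.

(* The image of mu under x |-> x / k, i.e. the measure mu(k dx). *)
Section rescaling.
Context {R : realType}.

Definition div_by (k : nat) (x : measurableTypeR R) : measurableTypeR R :=
  (x : R) / k%:R.

Lemma measurable_div_by k : measurable_fun [set: _] (div_by k).
Proof. by apply: (@measurable_funM _ _ R) => //; exact: measurable_cst. Qed.

HB.instance Definition _ k :=
  isMeasurableFun.Build _ _ _ _ (div_by k) (measurable_div_by k).

Definition rescale (k : nat) (mu : probR R) : probR R :=
  distribution mu (div_by k).

End rescaling.

Definition shift_pos {R : realType} (c : R)
  (x : measurableTypeR R) : measurableTypeR R := Num.max (x - c) 0.

Definition DR_model {R : realType} (alpha : R) (q : offspring R)
    (mu : nat -> probR R) : Prop :=
  [/\ 0 <= alpha <= 1,
      forall n, on_Rplus (mu n) &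
      forall n (A : set (measurableTypeR R)), measurable A ->
        mu n.+1 A = pushforward
          (fun B => (1 - alpha)%:E * mu n B
                    + alpha%:E * convolve (mu n) (conv_mix q (mu n)) B)%E
          (shift_pos 1) A].

(* Derivative at x of the restriction of f to D; one-sided at the endpoint
   when D is R_+ and x is 0. *)
Definition derivative_within {R : realType} (D : set R) (f : R -> R)
    (x l : R) : Prop :=
  (f y - f x) / (y - x) @[y --> within D x^'] --> l.

(* f, with derivative f', is in bC^1_*(R_+). *)
Definition bC1star {R : realType} (f f' : R -> R) : Prop :=
  [/\ {within Rplus, continuous f} /\ [bounded f x | x in Rplus],
      forall x : R, 0 <= x -> derivative_within Rplus f x (f' x),
      {within Rplus, continuous f'} /\ [bounded f' x | x in Rplus] &
      f' 0 = 0].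

Definition CDR_model {R : realType} (a : R) (q : offspring R)
    (mu : R -> probR R) : Prop :=
  (forall t : R, 0 <= t -> on_Rplus (mu t)) /\
  forall f f' : R -> R, bC1star f f' -> forall t : R, 0 <= t ->
    derivative_within Rplus (fun s => pairing (mu s) f) t
      (a * (pairing (convolve (mu t) (conv_mix q (mu t))) f - pairing (mu t) f)
       - pairing (mu t) (fun x => f' x * \1_[set y | 0 < y] x)).

Definition weak_cvg {R : realType} (nu : nat -> probR R) (mu : probR R)
    : Prop :=
  forall f : R -> R,
    {within Rplus, continuous f} -> [bounded f x | x in Rplus] ->
    pairing (nu k) f @[k --> \oo] --> pairing mu f.

(* Main.v *)
Require Import Defs.
From HB Require Import structures.
From mathcomp Require Import all_boot all_order all_algebra.
From mathcomp Require Import all_classical all_reals all_analysis.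
From mathcomp Require Import measurable_realfun ring lra.
Import Order.TTheory GRing.Theory Num.Theory.
Import numFieldNormedType.Exports.
Local Open Scope classical_set_scope.
Local Open Scope ring_scope.

(** The result is an instance of the principle that a stable and consistent
    numerical scheme converges: the rescaled discrete model is a one-step scheme
    with time step [h = 1/k] for the continuous one.

    Two probability measures on the half line are compared through the largest
    difference of their integrals over functions bounded by 1 and 1-Lipschitz
    ([lipb 1]).  This distance is never formed as a supremum: every estimate is
    a bound holding for all such functions.

    Stability.  Convolution does not expand the distance in either argument, so
    the i-th convolution power expands it at most [i] times, and
    [branch q : mu |-> mu * mu^q] at most [1 + m] times, [m] being the mean of
    [q] ([pairing_branch_dist]).  The truncated shift only composes the test
    function with a 1-Lipschitz map.  Hence one step of the scheme expands the
    distance by at most [1 + a (1 + m) h].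

    Consistency.  Test the two evolutions with a [tame] function: one that has a
    Lipschitz derivative and is constant on the negative half line.  For such a
    function the truncated shift by [h] is the plain translation by [h], and
    translates to the right are tame again.  One step of the scheme started at
    the continuous solution then differs from the continuous solution by
    O(h^2) ([CDR_step]).  It is essential that the constant does not involve the
    second derivative of the test function.  The obvious Taylor estimate
    ([CDR_step_rough]) does involve it, but that contribution disappears when the
    interval of length [h] is cut into [N] pieces and [N] tends to infinity:
    transport is treated exactly and only the branching term, which is Lipschitz
    in time, is frozen.

    Reduction to tame functions.  Translates [y |-> f (x + y)], which convolution
    produces, are no longer constant on the negative half line, so stability
    needs all Lipschitz functions while consistency is only available for tame
    ones.  The gap is closed by interpolating with quadratic B-splines: the
    interpolant of a [lipb 1] function is tame, and replacing the function by it
    costs a small error plus the mass far away, so tame functions already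
    determine the distance ([tame_dist_lipb]).

    A discrete Gronwall argument ([scheme_error]) bounds the distance at time [t]
    by a constant times the initial distance plus O(h).  The same interpolation,
    which reduces any test function to finitely many, shows that convergence in
    this distance is the same as weak convergence ([weak_cvg_unif],
    [lipb_cvg_weak]), which is used once at time 0 and once at time [t]. *)

(** * Integration against probability measures on the half line *)

Lemma eq_ler {R : realType} (x y : R) : x = y -> x <= y.
Proof. by move=> ->. Qed.

(** Only the values on the half line are constrained, as [pairing] sees no others. *)
Definition testable {R : realType} (f : R -> R) : Prop :=
  measurable_fun (Rplus : set (measurableTypeR R))
    (f : measurableTypeR R -> measurableTypeR R) /\
  exists K, forall x, 0 <= x -> `|f x| <= K.

Lemma measurable_Rplus {R : realType} :
  measurable (Rplus : set (measurableTypeR R)).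
Proof.
rewrite (_ : Rplus = `[0, +oo[%classic); first exact: measurable_itv.
by apply/seteqP; split => x /=; rewrite in_itv /= andbT.
Qed.

Section pairing_theory.
Context {R : realType} (mu : probR R).
Implicit Types f g : R -> R.

Lemma testable_integrable f : testable f ->
  mu.-integrable Rplus (EFin \o f).
Proof.
move=> [mf [K fK]]; apply: measurable_bounded_integrable => //.
- exact: measurable_Rplus.
- apply: le_lt_trans (probability_le1 mu measurable_Rplus) _; exact: ltry.
- exists K; split; first exact: num_real.
  by move=> M KM x /fK/le_trans; apply; exact: ltW.
Qed.

Lemma testable_cst c : testable (fun _ => c : R).
Proof. by split; [exact: measurable_cst|exists `|c|]. Qed.

Lemma testableD f g : testable f -> testable g -> testable (fun x => f x + g x).
Proof.
move=> [mf [K fK]] [mg [M gM]]; split; first exact: measurable_funD.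
exists (K + M) => x x0; apply: le_trans (ler_normD _ _) _.
by apply: lerD; [exact: fK|exact: gM].
Qed.

Lemma testableZ c f : testable f -> testable (fun x => c * f x).
Proof.
move=> [mf [K fK]]; split.
  by apply: measurable_funM => //; exact: measurable_cst.
by exists (`|c| * K) => x x0; rewrite normrM ler_wpM2l// fK.
Qed.

Lemma testableB f g : testable f -> testable g -> testable (fun x => f x - g x).
Proof.
move=> tf tg; rewrite (_ : (fun _ => _) = fun x => f x + (-1) * g x).
  by apply: testableD => //; exact: testableZ.
by apply/funext => x; rewrite mulN1r.
Qed.

Lemma pairingD f g : testable f -> testable g ->
  pairing mu (fun x => f x + g x) = pairing mu f + pairing mu g.
Proof.
move=> tf tg; apply: RintegralD; first exact: measurable_Rplus.
- exact: testable_integrable.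
- exact: testable_integrable.
Qed.

Lemma pairingB f g : testable f -> testable g ->
  pairing mu (fun x => f x - g x) = pairing mu f - pairing mu g.
Proof.
move=> tf tg; apply: RintegralB; first exact: measurable_Rplus.
- exact: testable_integrable.
- exact: testable_integrable.
Qed.

Lemma pairingZ c f : testable f ->
  pairing mu (fun x => c * f x) = c * pairing mu f.
Proof.
move=> tf; apply: RintegralZl; first exact: measurable_Rplus.
exact: testable_integrable.
Qed.

Lemma pairing_cst c : on_Rplus mu -> pairing mu (fun _ => c) = c.
Proof.
move=> muR; rewrite /pairing Rintegral_cst; last exact: measurable_Rplus.
by rewrite [X in fine X](muR : _ = 1%E) mulr1.
Qed.

Lemma eq_pairing f g : (forall x, 0 <= x -> f x = g x) ->
  pairing mu f = pairing mu g.
Proof. by move=> fg; apply: eq_Rintegral => x; rewrite inE => /fg. Qed.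

Lemma le_pairing f g : testable f -> testable g ->
  (forall x, 0 <= x -> f x <= g x) -> pairing mu f <= pairing mu g.
Proof.
move=> tf tg fg; apply: le_Rintegral => //; first exact: measurable_Rplus.
- exact: testable_integrable.
- exact: testable_integrable.
Qed.

Lemma pairing_dist_le f g h : testable f -> testable g -> testable h ->
  (forall x, 0 <= x -> `|f x - g x| <= h x) ->
  `|pairing mu f - pairing mu g| <= pairing mu h.
Proof.
move=> tf tg th fgh; rewrite ler_distl.
rewrite -pairingB// -pairingD//.
apply/andP; split; apply: le_pairing => //.
- exact: testableB.
- by move=> x /fgh; rewrite ler_distl => /andP[].
- exact: testableD.
- by move=> x /fgh; rewrite ler_distl => /andP[].
Qed.

Lemma pairing_dist_le_cst f g c : on_Rplus mu -> testable f -> testable g ->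
  (forall x, 0 <= x -> `|f x - g x| <= c) ->
  `|pairing mu f - pairing mu g| <= c.
Proof.
move=> muR tf tg fgc; rewrite -[leRHS]pairing_cst//.
by apply: pairing_dist_le => //; exact: testable_cst.
Qed.

Lemma pairing_norm_le f c : on_Rplus mu -> testable f ->
  (forall x, 0 <= x -> `|f x| <= c) -> `|pairing mu f| <= c.
Proof.
move=> muR tf fc; rewrite -[pairing mu f]subr0 -(pairing_cst 0 muR).
apply: pairing_dist_le_cst => //; first exact: testable_cst.
by move=> x /fc; rewrite subr0.
Qed.

Lemma pairing_add_cst c f : on_Rplus mu -> testable f ->
  pairing mu (fun x => f x + c) = pairing mu f + c.
Proof. by move=> muR tf; rewrite pairingD ?pairing_cst//; exact: testable_cst. Qed.

Lemma pairing_EFin f : testable f ->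
  ((pairing mu f)%:E = \int[mu]_(x in Rplus) (f x)%:E)%E.
Proof.
move=> tf; rewrite /pairing /Rintegral fineK//.
apply: integrable_fin_num; first exact: measurable_Rplus.
exact: testable_integrable.
Qed.

End pairing_theory.

(** Boundedness and the Lipschitz property are asked on the whole line and not
    only on [Rplus], so that translates of such functions are again of this kind
    and are continuous, hence measurable. *)
Definition lipb {R : realType} (K : R) (f : R -> R) : Prop :=
  (forall x, `|f x| <= K) /\ (forall x y, `|f x - f y| <= K * `|x - y|).

Section lipb_theory.
Context {R : realType}.
Implicit Types f g : R -> R.

Lemma lipb_ge0 (K : R) f : lipb K f -> 0 <= K.
Proof. by move=> [fK _]; exact: le_trans (fK 0). Qed.

Lemma lipb_continuous (K : R) f : lipb K f -> continuous f.
Proof.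
move=> fL; have K0 := lipb_ge0 _ _ fL; case: fL => _ fL x.
apply/cvgrPdist_lt => e e0; near=> y.
apply: le_lt_trans (fL _ _) _.
apply: (@le_lt_trans _ _ ((K + 1) * `|x - y|)); first by rewrite ler_wpM2r// lerDl.
rewrite mulrC -ltr_pdivlMr; last by rewrite ltr_wpDl.
near: y; apply: (@cvgr_dist_lt _ _ _ _ _ id x); first exact: cvg_id.
by rewrite divr_gt0// ltr_wpDl.
Unshelve. all: by end_near. Qed.

Lemma continuous_measurableR f (D : set (measurableTypeR R)) : continuous f ->
  measurable_fun D (f : measurableTypeR R -> measurableTypeR R).
Proof. by move=> cf; apply: measurable_funTS; exact: continuous_measurable_fun. Qed.

Lemma lipb_testable (K : R) f : lipb K f -> testable f.
Proof.
move=> fL; split; last by exists K => x _; case: fL.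
by apply: continuous_measurableR; exact: lipb_continuous fL.
Qed.

Lemma lipb_shift (K : R) f c : lipb K f -> lipb K (fun x => f (x + c)).
Proof.
move=> [fK fL]; split=> [x|x y]; first exact: fK.
by apply: le_trans (fL _ _) _; rewrite opprD addrACA subrr addr0.
Qed.

Lemma lipb_shiftl (K : R) f c : lipb K f -> lipb K (fun x => f (c + x)).
Proof.
move=> /(lipb_shift _ _ c); congr (lipb K _).
by apply/funext => x; rewrite addrC.
Qed.

Lemma lipbZ (K c : R) f : lipb K f -> lipb (`|c| * K) (fun x => c * f x).
Proof.
move=> [fK fL]; split=> [x|x y]; first by rewrite normrM ler_wpM2l.
by rewrite -mulrBr normrM -mulrA ler_wpM2l.
Qed.

(** Adding the bound [K] makes the function nonnegative, which gives access to the
    theorems on integrals of nonnegative functions against sums and series of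
    measures. *)
Lemma lipb_add_bound (K : R) f : lipb K f -> lipb (K + K) (fun x => f x + K).
Proof.
move=> fL; have K0 := lipb_ge0 _ _ fL; case: fL => fK fL.
split=> [x|x y].
  by apply: le_trans (ler_normD _ _) _; rewrite lerD// ger0_norm.
rewrite opprD addrACA subrr addr0; apply: le_trans (fL _ _) _.
by rewrite ler_wpM2r// lerDl.
Qed.

Lemma lipb_add_bound_ge0 (K : R) f : lipb K f -> forall x, 0 <= f x + K.
Proof. by move=> [fK _] x; have := fK x; rewrite ler_norml; lra. Qed.

Lemma lipb_div (K : R) f (k : nat) : (1 <= k)%N -> lipb K f ->
  lipb K (fun x => f (x / k%:R)).
Proof.
move=> k1 fL; have K0 := lipb_ge0 _ _ fL; case: fL => fK fL.
split=> [x|x y]; first exact: fK.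
apply: le_trans (fL _ _) _; rewrite ler_wpM2l// -mulrBl normrM ler_piMr//.
rewrite ger0_norm// invf_le1 ?ler1n// ltr0n; exact: k1.
Qed.

(** Averaging the translates of a Lipschitz function keeps its constants; this is
    what makes iterated integrals of Lipschitz functions manageable. *)
Lemma lipb_pairing (K : R) (nu : probR R) f : on_Rplus nu -> lipb K f ->
  lipb K (fun x => pairing nu (fun y => f (x + y))).
Proof.
move=> nuR fL; have tf x : testable (fun y => f (x + y)).
  by apply: (@lipb_testable K); exact: lipb_shiftl.
split=> [x|x y].
  by apply: pairing_norm_le => // y _; case: fL.
apply: pairing_dist_le_cst => // z _.
case: fL => _ /(_ (x + z) (y + z)).
by rewrite opprD addrACA subrr addr0.
Qed.

Lemma lipb_scale_dist (K d : R) (mu nu : probR R) f : 0 <= d ->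
  (forall g, lipb 1 g -> `|pairing mu g - pairing nu g| <= d) ->
  lipb K f -> `|pairing mu f - pairing nu f| <= K * d.
Proof.
move=> d0 H fL; have := lipb_ge0 _ _ fL; rewrite le_eqVlt => /predU1P[K0|K0].
  have f0 x : f x = 0.
    by apply/eqP; rewrite -normr_le0; case: fL; rewrite -K0.
  have pf m : pairing m f = pairing m (fun x => 0 * f x).
    by apply: eq_pairing => x; rewrite mul0r f0.
  by rewrite !pf !pairingZ ?mul0r ?subrr ?normr0 -?K0 ?mul0r//;
    exact: lipb_testable fL.
have tf := lipb_testable _ _ fL.
have := H (fun x => K^-1 * f x).
rewrite !pairingZ// -mulrBr normrM gtr0_norm ?invr_gt0//.
rewrite ler_pdivrMl//; apply.
have := lipbZ _ K^-1 _ fL; rewrite gtr0_norm ?invr_gt0// mulVf//.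
by rewrite gt_eqF.
Qed.

End lipb_theory.

(** * Convolution and the branching operator *)

Section convolution_theory.
Context {R : realType}.
Implicit Types (f : R -> R) (mu nu : probR R).

Lemma on_RplusC mu : on_Rplus mu -> mu (~` Rplus) = 0%E.
Proof.
move=> muR; have /= := probability_setC mu (@measurable_Rplus R).
by move=> ->; rewrite muR subee.
Qed.

Lemma lipb_integrable (K : R) mu f : lipb K f -> mu.-integrable setT (EFin \o f).
Proof.
move=> fL; apply: measurable_bounded_integrable => //.
- by apply: le_lt_trans (probability_le1 mu measurableT) _; exact: ltry.
- by apply: continuous_measurableR; exact: lipb_continuous fL.
- exists K; split; first exact: num_real.
  by move=> M KM x _; case: fL => /(_ x)/le_trans + _; apply; exact: ltW.
Qed.

Lemma pairing_setT (K : R) mu f : on_Rplus mu -> lipb K f ->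
  ((pairing mu f)%:E = \int[mu]_x (f x)%:E)%E.
Proof.
move=> muR fL; rewrite pairing_EFin; last exact: lipb_testable fL.
have mN : measurable (~` Rplus : set (measurableTypeR R)).
  by apply: measurableC; exact: measurable_Rplus.
have := @negligible_integral _ _ _ mu _ _ _ mN measurableT (lipb_integrable _ mu _ fL) (on_RplusC _ muR).
by rewrite setTD setCK => <-.
Qed.

Lemma convolve_on_Rplus mu nu : on_Rplus mu -> on_Rplus nu ->
  on_Rplus (convolve mu nu).
Proof.
move=> muR nuR; apply/eqP; rewrite eq_le; apply/andP; split.
  exact: (probability_le1 (convolve mu nu) measurable_Rplus).
have mRR : measurable ((Rplus : set (measurableTypeR R)) `*` (Rplus : set (measurableTypeR R))).
  by apply: measurableX; exact: measurable_Rplus.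
have : (mu \x nu)%E (Rplus `*` Rplus) = 1%E.
  transitivity (mu Rplus * nu Rplus)%E; last by rewrite muR nuR mule1.
  by apply: product_measure1E; exact: measurable_Rplus.
move=> <-; rewrite /convolve /distribution/= /pushforward.
apply: le_measure; rewrite ?inE//.
- rewrite -[X in measurable X]setTI; apply: measurable_add_pair => //.
  exact: measurable_Rplus.
- by move=> [x y] [/= x0 y0]; rewrite /Rplus/= /Defs.add_pair/= addr_ge0.
Qed.

Lemma pairing_convolve (K : R) mu nu f : on_Rplus mu -> on_Rplus nu ->
  lipb K f ->
  pairing (convolve mu nu) f =
  pairing mu (fun x => pairing nu (fun y => f (x + y))).
Proof.
move=> muR nuR fL; apply: EFin_inj.
rewrite (pairing_setT K)//; last exact: convolve_on_Rplus.
rewrite (pairing_setT K)//; last exact: lipb_pairing.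
have mf : measurable_fun setT (f : measurableTypeR R -> measurableTypeR R).
  by apply: continuous_measurableR; exact: lipb_continuous fL.
have mfa : measurable_fun setT (f \o Defs.add_pair : _ -> measurableTypeR R).
  by apply: measurableT_comp => //; exact: measurable_add_pair.
have intf : (mu \x nu)%E.-integrable setT (EFin \o f \o Defs.add_pair).
  apply: (@measurable_bounded_integrable _ _ _ _ (f \o Defs.add_pair)) => //.
  - by apply: le_lt_trans (probability_le1 _ measurableT) _; exact: ltry.
  - exists K; split; first exact: num_real.
    by move=> M KM x _; case: fL => /(_ (Defs.add_pair x))/le_trans + _; apply; exact: ltW.
rewrite /convolve integral_distribution//; last exact/measurable_EFinP.
rewrite -integral12_prod_meas1//.
apply: eq_integral => x _; rewrite /fubini_F/= (pairing_setT K)//.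
exact: lipb_shiftl.
Qed.

Lemma conv_pow_on_Rplus mu i : on_Rplus mu -> on_Rplus (conv_pow mu i).
Proof.
move=> muR; elim: i => [|i IH] /=; last exact: convolve_on_Rplus.
by rewrite /on_Rplus/= diracE mem_set//= /Rplus/= lexx.
Qed.

Lemma conv_mix_on_Rplus (q : offspring R) mu : on_Rplus mu ->
  on_Rplus (conv_mix q mu).
Proof.
move=> muR; rewrite /on_Rplus [LHS]conv_mixE -(offspring_sum q).
by apply: eq_eseriesr => i _; rewrite (conv_pow_on_Rplus mu i muR) mule1.
Qed.

Lemma offspring_ge0E (q : offspring R) i : (0 <= (q i)%:E)%E.
Proof. by rewrite lee_fin offspring_ge0. Qed.

(** The sum starts at 0 instead of 1, harmlessly since [q] gives no mass to 0. *)
Lemma pairing_conv_mix_ge0 (q : offspring R) (K : R) mu f : on_Rplus mu -> lipb K f ->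
  (forall x, 0 <= f x) ->
  ((pairing (conv_mix q mu) f)%:E =
  \sum_(0 <= i <oo) (q i)%:E * (pairing (conv_pow mu i) f)%:E)%E.
Proof.
move=> muR fL f0; rewrite pairing_EFin; last exact: lipb_testable fL.
pose m i : {measure set (measurableTypeR R) -> \bar R} :=
  mscale (NngNum (offspring_ge0 q i)) (conv_pow mu i).
transitivity (\int[mseries m 0]_(x in Rplus) (f x)%:E)%E.
  apply: eq_measure_integral => A mA _.
  rewrite [LHS]/= /conv_mix /mseries [RHS](nneseries_split 0 1)//.
  by rewrite add0n big_nat1 /m/= /mscale/= offspring_at0 mul0e add0e.
have mf : measurable_fun (Rplus : set (measurableTypeR R)) (EFin \o f : measurableTypeR R -> _).
  by apply/measurable_EFinP; case: (lipb_testable _ _ fL).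
have f0' x : Rplus x -> (0 <= (EFin \o f) x)%E by move=> _; rewrite lee_fin.
rewrite (@ge0_integral_measure_series _ _ _ m _ measurable_Rplus _ f0' mf).
apply: eq_eseriesr => i _.
rewrite (@ge0_integral_mscale _ _ _ (conv_pow mu i) _ measurable_Rplus _ _ mf f0').
by rewrite pairing_EFin//; exact: lipb_testable fL.
Qed.

(** The measures and the functions both vary, so that the statement serves to
    compare mixtures of two measures ([f = g]) as well as to identify mixtures
    before and after rescaling ([d = 0]). *)
Lemma pairing_conv_mix_le (q : offspring R) (m K d : R) mu nu f g :
  (\sum_(0 <= i <oo) (i%:R * q i)%:E = m%:E)%E -> 0 <= d ->
  on_Rplus mu -> on_Rplus nu -> lipb K f -> lipb K g ->
  (forall i, pairing (conv_pow mu i) f <= pairing (conv_pow nu i) g + i%:R * d) ->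
  pairing (conv_mix q mu) f <= pairing (conv_mix q nu) g + m * d.
Proof.
move=> mE d0 muR nuR fL gL fg.
have fL' := lipb_add_bound _ _ fL; have f0 := lipb_add_bound_ge0 _ _ fL.
have gL' := lipb_add_bound _ _ gL; have g0 := lipb_add_bound_ge0 _ _ gL.
have tf := lipb_testable _ _ fL; have tg := lipb_testable _ _ gL.
rewrite -(lerD2r K) addrAC -!(pairing_add_cst _ K)//; try exact: conv_mix_on_Rplus.
rewrite -lee_fin EFinD EFinM (pairing_conv_mix_ge0 _ _ _ _ muR fL' f0).
rewrite (pairing_conv_mix_ge0 _ _ _ _ nuR gL' g0) -mE.
have q0 i : (0 <= (i%:R * q i)%:E)%E.
  by rewrite lee_fin mulr_ge0// offspring_ge0.
(* nonnegativity, required by the theorems on series of extended reals *)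
have gpos i : (0 <= (q i)%:E * (pairing (conv_pow nu i) (fun x => g x + K))%:E)%E.
  rewrite mule_ge0 ?offspring_ge0E// lee_fin; apply: Rintegral_ge0 => x _.
  exact: g0.
rewrite muleC -nneseriesZl//.
rewrite -nneseriesD//; last by move=> i _ _; rewrite mule_ge0// ?lee_fin.
apply: lee_nneseries => [i _ _|i _].
  rewrite mule_ge0 ?offspring_ge0E// lee_fin; apply: Rintegral_ge0 => x _.
  exact: f0.
rewrite -!EFinM -EFinD lee_fin.
have -> : d * (i%:R * q i) = q i * (i%:R * d) by ring.
rewrite -mulrDr ler_wpM2l ?offspring_ge0// !pairing_add_cst//; last 2 first.
- exact: conv_pow_on_Rplus.
- exact: conv_pow_on_Rplus.
by rewrite addrAC lerD2r fg.
Qed.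

(** Each of the [i] factors is exchanged in turn at the cost [d]: with the other
    factors fixed, the integrand is an average of translates of [f]. *)
Lemma pairing_conv_pow_dist mu nu (d : R) i f : 0 <= d ->
  on_Rplus mu -> on_Rplus nu ->
  (forall g, lipb 1 g -> `|pairing mu g - pairing nu g| <= d) ->
  lipb 1 f ->
  `|pairing (conv_pow mu i) f - pairing (conv_pow nu i) f| <= i%:R * d.
Proof.
move=> d0 muR nuR H; elim: i f => [|i IH] f fL /=.
  by rewrite subrr normr0 mul0r.
rewrite !(pairing_convolve 1)//; try exact: conv_pow_on_Rplus.
set F := fun x => pairing (conv_pow mu i) _.
set G := fun x => pairing (conv_pow nu i) _.
have FL : lipb 1 F by apply: lipb_pairing => //; exact: conv_pow_on_Rplus.
have GL : lipb 1 G by apply: lipb_pairing => //; exact: conv_pow_on_Rplus.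
apply: le_trans (ler_distD (pairing mu G) _ _) _.
rewrite -natr1 mulrDl mul1r lerD//; last exact: H.
apply: pairing_dist_le_cst => //; try by apply: (@lipb_testable R 1).
by move=> x _; apply: IH; exact: lipb_shiftl.
Qed.

Definition branch (q : offspring R) mu : probR R :=
  convolve mu (conv_mix q mu).

Lemma branch_on_Rplus q mu : on_Rplus mu -> on_Rplus (branch q mu).
Proof. by move=> muR; apply: convolve_on_Rplus => //; exact: conv_mix_on_Rplus. Qed.

Lemma pairing_conv_mix_dist (q : offspring R) mu nu (m d : R) f :
  (\sum_(0 <= i <oo) (i%:R * q i)%:E = m%:E)%E -> 0 <= d ->
  on_Rplus mu -> on_Rplus nu ->
  (forall g, lipb 1 g -> `|pairing mu g - pairing nu g| <= d) ->
  lipb 1 f ->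
  `|pairing (conv_mix q mu) f - pairing (conv_mix q nu) f| <= m * d.
Proof.
move=> mE d0 muR nuR H fL.
have pow i : `|pairing (conv_pow mu i) f - pairing (conv_pow nu i) f| <= i%:R * d.
  exact: pairing_conv_pow_dist.
rewrite ler_distl lerBlDr; apply/andP; split.
  apply: (pairing_conv_mix_le q m 1) => // i.
  by have := pow i; rewrite ler_distl lerBlDr => /andP[].
apply: (pairing_conv_mix_le q m 1) => // i.
by have := pow i; rewrite ler_distl => /andP[].
Qed.

(** The factor 1 is for [mu] itself and [m] for its mixture: the [i]-fold
    convolution costs [i * d], and [m] is the mean of [q]. *)
Lemma pairing_branch_dist (q : offspring R) mu nu (m d : R) f :
  (\sum_(0 <= i <oo) (i%:R * q i)%:E = m%:E)%E -> 0 <= d ->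
  on_Rplus mu -> on_Rplus nu ->
  (forall g, lipb 1 g -> `|pairing mu g - pairing nu g| <= d) ->
  lipb 1 f ->
  `|pairing (branch q mu) f - pairing (branch q nu) f| <= (1 + m) * d.
Proof.
move=> mE d0 muR nuR H fL.
rewrite !(pairing_convolve 1)//; try exact: conv_mix_on_Rplus.
set F := fun x => pairing (conv_mix q mu) _.
set G := fun x => pairing (conv_mix q nu) _.
have FL : lipb 1 F by apply: lipb_pairing => //; exact: conv_mix_on_Rplus.
have GL : lipb 1 G by apply: lipb_pairing => //; exact: conv_mix_on_Rplus.
apply: le_trans (ler_distD (pairing mu G) _ _) _.
rewrite mulrDl mul1r addrC lerD//; first exact: H.
apply: pairing_dist_le_cst => //; try by apply: (@lipb_testable R 1).
by move=> x _; apply: pairing_conv_mix_dist => //; exact: lipb_shiftl.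
Qed.

End convolution_theory.

(** * Rescaling and one step of the discrete model *)

Section rescaling_theory.
Context {R : realType}.
Implicit Types (f : R -> R) (mu nu : probR R) (q : offspring R).

Lemma rescale_on_Rplus k nu : on_Rplus nu -> on_Rplus (rescale k nu).
Proof.
move=> nuR; rewrite /on_Rplus; apply/eqP; rewrite eq_le; apply/andP; split.
  exact: (probability_le1 (rescale k nu) measurable_Rplus).
rewrite -[leLHS](nuR : _ = 1%E) /rescale /distribution/= /pushforward.
apply: le_measure; rewrite ?inE//.
- exact: measurable_Rplus.
- rewrite -[X in measurable X]setTI; apply: measurable_div_by => //.
  exact: measurable_Rplus.
- by move=> x; rewrite /Rplus/= /div_by => x0; rewrite divr_ge0.
Qed.

Lemma pairing_rescale (K : R) k nu f : (1 <= k)%N -> on_Rplus nu -> lipb K f ->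
  pairing (rescale k nu) f = pairing nu (fun x => f (x / k%:R)).
Proof.
move=> k1 nuR fL; apply: EFin_inj.
rewrite (pairing_setT K)//; last exact: rescale_on_Rplus.
rewrite (pairing_setT K)//; last exact: lipb_div.
have mf : measurable_fun setT (f : measurableTypeR R -> measurableTypeR R).
  by apply: continuous_measurableR; exact: lipb_continuous fL.
rewrite /rescale integral_distribution//; first exact/measurable_EFinP.
exact: (lipb_integrable K nu (fun x => f (x / k%:R)) (lipb_div _ _ _ k1 fL)).
Qed.

Lemma pairing_conv_pow_rescale (K : R) k nu i f : (1 <= k)%N -> on_Rplus nu ->
  lipb K f ->
  pairing (conv_pow (rescale k nu) i) f =
  pairing (conv_pow nu i) (fun x => f (x / k%:R)).
Proof.
move=> k1 nuR; elim: i f => [|i IH] f fL /=.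
  have d0 (g : R -> R) : lipb K g -> pairing (\d_(0 : measurableTypeR R)) g = g 0.
    move=> gL; apply: EFin_inj.
    rewrite (@pairing_setT R K); last exact: gL.
    - rewrite (@integral_dirac _ _ _ _ _ measurableT).
        by rewrite diracT mul1e.
      apply/measurable_EFinP; apply: continuous_measurableR.
      exact: lipb_continuous gL.
    - exact: (conv_pow_on_Rplus nu 0 nuR).
  rewrite !d0 ?mul0r//.
  exact: lipb_div.
have rR := rescale_on_Rplus k nu nuR.
have fL' := lipb_div _ _ _ k1 fL.
have mR := conv_pow_on_Rplus _ i rR; have nR := conv_pow_on_Rplus _ i nuR.
rewrite (pairing_convolve K _ _ _ rR mR fL).
rewrite [RHS](pairing_convolve K _ _ _ nuR nR fL').
have FL := lipb_pairing K _ _ mR fL.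
rewrite (pairing_rescale K k nu _ k1 nuR FL).
apply: eq_pairing => x x0.
rewrite (IH (fun y => f (x / k%:R + y)) (lipb_shiftl _ _ (x / k%:R) fL)).
by apply: eq_pairing => y y0; rewrite mulrDl.
Qed.

Lemma pairing_conv_mix_rescale q (m K : R) k nu f :
  (\sum_(0 <= i <oo) (i%:R * q i)%:E = m%:E)%E ->
  (1 <= k)%N -> on_Rplus nu -> lipb K f ->
  pairing (conv_mix q (rescale k nu)) f =
  pairing (conv_mix q nu) (fun x => f (x / k%:R)).
Proof.
move=> mE k1 nuR fL; have rR := rescale_on_Rplus k nu nuR.
have fL' := lipb_div _ _ _ k1 fL.
have powE i := pairing_conv_pow_rescale K k nu i f k1 nuR fL.
apply/eqP; rewrite eq_le; apply/andP; split.
- have := @pairing_conv_mix_le _ _ _ _ _ _ _ _ _ mE (lexx 0) rR nuR fL fL'.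
  by rewrite mulr0 addr0; apply=> i; rewrite powE mulr0 addr0.
- have := @pairing_conv_mix_le _ _ _ _ _ _ _ _ _ mE (lexx 0) nuR rR fL' fL.
  by rewrite mulr0 addr0; apply=> i; rewrite powE mulr0 addr0.
Qed.

(** Division by [k] is additive, so rescaling commutes with convolution. *)
Lemma pairing_branch_rescale q (m K : R) k nu f :
  (\sum_(0 <= i <oo) (i%:R * q i)%:E = m%:E)%E ->
  (1 <= k)%N -> on_Rplus nu -> lipb K f ->
  pairing (branch q (rescale k nu)) f =
  pairing (branch q nu) (fun x => f (x / k%:R)).
Proof.
move=> mE k1 nuR fL; have rR := rescale_on_Rplus k nu nuR.
have fL' := lipb_div _ _ _ k1 fL.
have mR := conv_mix_on_Rplus q _ rR; have nR := conv_mix_on_Rplus q _ nuR.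
rewrite /branch (pairing_convolve K _ _ _ rR mR fL).
rewrite [RHS](pairing_convolve K _ _ _ nuR nR fL').
have FL := lipb_pairing K _ _ mR fL.
rewrite (pairing_rescale K k nu _ k1 nuR FL).
apply: eq_pairing => x x0.
rewrite (pairing_conv_mix_rescale q m K k nu _ mE k1 nuR (lipb_shiftl _ _ (x / k%:R) fL)).
by apply: eq_pairing => y y0; rewrite mulrDl.
Qed.

Lemma lipb_shift_pos (K : R) f : lipb K f -> lipb K (fun x => f (shift_pos 1 x)).
Proof.
move=> fL; have K0 := lipb_ge0 _ _ fL; case: fL => fK fL.
split=> [x|x y]; first exact: fK.
apply: le_trans (fL _ _) _; rewrite ler_wpM2l// /shift_pos.
rewrite !maxEle; case: ifPn; case: ifPn; rewrite -?ltNge => h1 h2.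
- by rewrite subrr normr0.
- by rewrite ler_norml; have := ler_norm (y - x); rewrite distrC; lra.
- by rewrite ler_norml; have := ler_norm (x - y); lra.
- by rewrite opprB addrA subrK.
Qed.

Lemma measurable_shift_pos : measurable_fun setT (@shift_pos R 1).
Proof.
have -> : @shift_pos R 1 = (fun x : measurableTypeR R => (x : R) - 1 : R) \max (fun=> 0 : R).
  by [].
by apply: measurable_maxr => //; apply: measurable_funB => //; exact: measurable_id.
Qed.

Lemma pairing_DR_step (alpha K : R) q (nu : nat -> probR R) n f :
  DR_model alpha q nu -> lipb K f ->
  pairing (nu n.+1) f =
  (1 - alpha) * pairing (nu n) (fun x => f (shift_pos 1 x)) +
  alpha * pairing (branch q (nu n)) (fun x => f (shift_pos 1 x)).
Proof.
move=> [/andP[a0 a1] nuR step] fL.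
have bR : on_Rplus (branch q (nu n)) by exact: branch_on_Rplus.
have K0 := lipb_ge0 _ _ fL.
(* As the integral against a sum of measures is split for nonnegative
   functions, [f] is first replaced by [f + K]. *)
pose g x := f x + K.
have gL : lipb (K + K) g by exact: lipb_add_bound.
have g0 : forall x, 0 <= g x by exact: lipb_add_bound_ge0.
suff : pairing (nu n.+1) g =
  (1 - alpha) * pairing (nu n) (fun x => g (shift_pos 1 x)) +
  alpha * pairing (branch q (nu n)) (fun x => g (shift_pos 1 x)).
  have tf := lipb_testable _ _ fL.
  have ts := lipb_testable _ _ (lipb_shift_pos _ _ fL).
  by rewrite /g !pairing_add_cst//; lra.
have sL := lipb_shift_pos _ _ gL.
apply: EFin_inj; rewrite EFinD !EFinM !(pairing_setT (K + K))//.
have b0 : 0 <= 1 - alpha by rewrite subr_ge0.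
pose m1 : {measure set (measurableTypeR R) -> \bar R} := mscale (NngNum b0) (nu n).
pose m2 : {measure set (measurableTypeR R) -> \bar R} := mscale (NngNum a0) (branch q (nu n)).
have -> : (\int[nu n.+1]_x (g x)%:E =
    \int[pushforward (measure_add m1 m2) (@shift_pos R 1)]_x (g x)%:E)%E.
  apply: eq_measure_integral => [|? A mA _]; first exact: measurable_shift_pos.
  apply: (etrans (step n A mA)); rewrite /pushforward.
  by rewrite [RHS]measure_addE.
have mg : measurable_fun setT (EFin \o g : measurableTypeR R -> _).
  by apply/measurable_EFinP; apply: continuous_measurableR; exact: lipb_continuous gL.
have ms : measurable_fun setT (EFin \o g \o shift_pos 1 : measurableTypeR R -> _).
  apply/measurable_EFinP.
  by apply: (@continuous_measurableR R (fun x => g (shift_pos 1 x))); exact: lipb_continuous sL.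
rewrite (ge0_integral_pushforward measurable_shift_pos _ measurableT mg); last first.
  by move=> x _; rewrite lee_fin.
rewrite preimage_setT ge0_integral_measure_add//; last by move=> x _; rewrite lee_fin.
by congr (_ + _)%E; rewrite ge0_integral_mscale// => x _; rewrite lee_fin.
Qed.

End rescaling_theory.

(** * Tame test functions and quadratic splines *)

(** Differentiability is expressed by a quantitative Taylor bound, which is the form
    needed when the bound has to be uniform in a family of translates.  Constancy
    on the negative half line makes [f] composed with the truncated shift
    by [h] equal to the translate [x |-> f (x - h)]. *)
Record tame {R : realType} (L : R) (f f' : R -> R) : Prop := Tame {
  tame_lipb : lipb 1 f ;
  tame_bound' : forall x, `|f' x| <= 1 ;
  tame_lip' : forall x y, `|f' x - f' y| <= L * `|x - y| ;
  tame_taylor : forall x y, `|f y - f x - f' x * (y - x)| <= L * (y - x) ^+ 2 ;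
  tame_neg : forall x, x <= 0 -> f x = f 0 ;
  tame_neg' : forall x, x <= 0 -> f' x = 0 }.

Section splines.
Context {R : realType}.
Implicit Types (x y : R).

Definition ramp x : R := Num.max x 0.
Definition qramp x : R := (ramp x) ^+ 2 / 2.

Lemma rampP x : (ramp x = x /\ 0 <= x) \/ (ramp x = 0 /\ x <= 0).
Proof.
rewrite /ramp maxEle; case: (leP x 0) => h; first by right.
by left; split=> //; exact: ltW.
Qed.

Lemma ramp_lip x y : `|ramp x - ramp y| <= `|x - y|.
Proof.
rewrite ler_norml; have := ler_norm (x - y); have := ler_norm (y - x).
rewrite (distrC y x).
by case: (rampP x) => -[-> ?]; case: (rampP y) => -[-> ?]; lra.
Qed.

Lemma qramp_taylor x y :
  `|qramp y - qramp x - ramp x * (y - x)| <= (y - x) ^+ 2.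
Proof.
rewrite ler_norml /qramp; have sq := sqr_ge0 (y - x).
by case: (rampP x) => -[-> ?]; case: (rampP y) => -[-> ?]; apply/andP; split; nra.
Qed.

(** The integral of the piecewise linear hat on [[0, 2]]: a second difference of
    [qramp].  Integer translates of the hat add up to 1, which is why interpolation
    with these steps does not increase Lipschitz constants. *)
Definition step y : R := qramp y - 2 * qramp (y - 1) + qramp (y - 2).
Definition step' y : R := ramp y - 2 * ramp (y - 1) + ramp (y - 2).

Lemma step_mono x y : x <= y -> step x <= step y.
Proof.
move=> xy; rewrite /step /qramp.
by case: (rampP x) => -[-> ?]; case: (rampP y) => -[-> ?];
   case: (rampP (x - 1)) => -[-> ?]; case: (rampP (y - 1)) => -[-> ?];
   case: (rampP (x - 2)) => -[-> ?]; case: (rampP (y - 2)) => -[-> ?]; try nra.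
Qed.

Lemma step_lo y : y <= 0 -> step y = 0.
Proof.
move=> y0; rewrite /step /qramp.
by case: (rampP y) => -[-> ?];
   case: (rampP (y - 1)) => -[-> ?];
   case: (rampP (y - 2)) => -[-> ?]; try nra.
Qed.

Lemma step_hi y : 2 <= y -> step y = 1.
Proof.
move=> y0; rewrite /step /qramp.
by case: (rampP y) => -[-> ?];
   case: (rampP (y - 1)) => -[-> ?];
   case: (rampP (y - 2)) => -[-> ?]; try nra; lra.
Qed.

Lemma step_ge0 y : 0 <= step y.
Proof.
case: (leP y 0) => [/step_lo ->//|/ltW y0].
by rewrite -(@step_lo 0)//; exact: step_mono.
Qed.

Lemma step_le1 y : step y <= 1.
Proof.
case: (leP 2 y) => [/step_hi ->//|/ltW y0].
by rewrite -(@step_hi 2)//; exact: step_mono.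
Qed.

Lemma step'_ge0 y : 0 <= step' y.
Proof.
rewrite /step'.
by case: (rampP y) => -[-> ?];
   case: (rampP (y - 1)) => -[-> ?];
   case: (rampP (y - 2)) => -[-> ?]; lra.
Qed.

Lemma step'_lo y : y <= 0 -> step' y = 0.
Proof.
move=> y0; rewrite /step'.
by case: (rampP y) => -[-> ?];
   case: (rampP (y - 1)) => -[-> ?];
   case: (rampP (y - 2)) => -[-> ?]; lra.
Qed.

Lemma step'_lip x y : `|step' x - step' y| <= 4 * `|x - y|.
Proof.
have h c : `|ramp (x - c) - ramp (y - c)| <= `|x - y|.
  by apply: le_trans (ramp_lip _ _) _; rewrite opprB addrA subrK.
have := ramp_lip x y; have := h 1; have := h 2.
rewrite !ler_norml /step'; lra.
Qed.

Lemma step_taylor x y : `|step y - step x - step' x * (y - x)| <= 4 * (y - x) ^+ 2.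
Proof.
have h c : `|qramp (y - c) - qramp (x - c) - ramp (x - c) * (y - x)| <= (y - x) ^+ 2.
  have := qramp_taylor (x - c) (y - c).
  by have -> : y - c - (x - c) = y - x by ring.
have := qramp_taylor x y; have := h 1; have := h 2.
rewrite !ler_norml /step /step'.
have -> : (ramp x - 2 * ramp (x - 1) + ramp (x - 2)) * (y - x) =
  ramp x * (y - x) - 2 * (ramp (x - 1) * (y - x)) + ramp (x - 2) * (y - x) by ring.
lra.
Qed.

Lemma sum_step N y :
  \sum_(0 <= i < N) step (y - i%:R) =
  (qramp y - qramp (y - 1)) - (qramp (y - N%:R) - qramp (y - N%:R - 1)).
Proof.
elim: N => [|N IH]; first by rewrite big_geq// !subr0 subrr.
rewrite big_nat_recr//= IH /step -[N.+1%:R]natr1.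
have -> : y - (N%:R + 1) = y - N%:R - 1 by ring.
have -> : y - N%:R - 1 - 1 = y - N%:R - 2 by ring.
ring.
Qed.

Lemma sum_step' N y :
  \sum_(0 <= i < N) step' (y - i%:R) =
  (ramp y - ramp (y - 1)) - (ramp (y - N%:R) - ramp (y - N%:R - 1)).
Proof.
elim: N => [|N IH]; first by rewrite big_geq// !subr0 subrr.
rewrite big_nat_recr//= IH /step' -[N.+1%:R]natr1.
have -> : y - (N%:R + 1) = y - N%:R - 1 by ring.
have -> : y - N%:R - 1 - 1 = y - N%:R - 2 by ring.
ring.
Qed.

(** Integer translates of [step] telescope to a function whose slope stays
    between 0 and 1. *)
Lemma sum_step_lip N x y : x <= y ->
  \sum_(0 <= i < N) (step (y - i%:R) - step (x - i%:R)) <= y - x.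
Proof.
move=> xy; rewrite sumrB !sum_step.
have h u v : u <= v -> 0 <= (qramp v - qramp (v - 1)) - (qramp u - qramp (u - 1)) <= v - u.
  rewrite /qramp => uv; case: (rampP u) => -[-> ?]; case: (rampP v) => -[-> ?];
   case: (rampP (u - 1)) => -[-> ?]; case: (rampP (v - 1)) => -[-> ?]; apply/andP; split; nra.
have /andP[_ h1] := h x y xy.
have xyN : x - N%:R <= y - N%:R by rewrite lerD2r.
have /andP[h2 _] := h _ _ xyN; lra.
Qed.

Lemma sum_step'_le1 N y : \sum_(0 <= i < N) step' (y - i%:R) <= 1.
Proof.
rewrite sum_step'.
have h u : 0 <= ramp u - ramp (u - 1) <= 1.
  by case: (rampP u) => -[-> ?]; case: (rampP (u - 1)) => -[-> ?]; lra.
by have /andP[_ ] := h y; have /andP[] := h (y - N%:R); lra.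
Qed.

End splines.

(** * Spline interpolation *)

Section spline_approx.
Context {R : realType}.
Variable w : R.
Hypothesis w0 : 0 < w.
Implicit Types (x y : R) (f : R -> R) (N i : nat).

Definition knot i : R := i%:R * w.

(** With mesh [w], the differences [tail i - tail i.+1] form a partition of unity
    subordinate to the knots: the [i]-th one lives within [2 * w] of [knot i].
    The last one, [tail N], collects everything to the right of the grid. *)
Definition tail i x : R := if i is j.+1 then step (x / w - j%:R) else 1.

(** Summation by parts of the interpolation of [f] by that partition of unity.
    In this form the slope is visible; the other form is implicit in
    [spline_dist]. *)
Definition spline f N x : R :=
  f 0 + \sum_(0 <= i < N) (f (knot i.+1) - f (knot i)) * tail i.+1 x.

Definition spline' f N x : R :=
  \sum_(0 <= i < N) (f (knot i.+1) - f (knot i)) * (step' (x / w - i%:R) / w).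

Lemma tail_ge0 i x : 0 <= tail i x.
Proof. by case: i => //= i; exact: step_ge0. Qed.

Lemma tail_le1 i x : tail i x <= 1.
Proof. by case: i => //= i; exact: step_le1. Qed.

Lemma tail_decr i x : tail i.+1 x <= tail i x.
Proof.
case: i => [|i] /=; first exact: step_le1.
by apply: step_mono; rewrite lerD2l lerN2 ler_nat.
Qed.

(** The [i]-th weight of the partition of unity is supported near its knot. *)
Lemma tail_weight0 i x : 0 <= x -> 2 * w <= `|x - knot i| ->
  tail i x - tail i.+1 x = 0.
Proof.
move=> x0; have -> : x = (x / w) * w by rewrite divfK ?gt_eqF.
rewrite /knot -mulrBl normrM (gtr0_norm w0) ler_pM2r//.
have y0 : 0 <= x / w by rewrite divr_ge0// ltW.
have yE : x / w * w / w = x / w by rewrite mulfK ?gt_eqF.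
rewrite ler_normr => /orP[h|h]; case: i h => [|i] h; rewrite /tail yE.
- by rewrite step_hi ?subrr.
- by rewrite !step_hi ?subrr//; move: h; rewrite -natr1; lra.
- by exfalso; lra.
- by rewrite !step_lo ?subrr//; move: h; rewrite -natr1; lra.
Qed.

(** The spline is a weighted mean of values of [f] at the knots.  Taking [c = 0]
    bounds the spline; taking [c = f x] measures the interpolation error at [x],
    where only knots close to [x] have nonzero weight.  The value at the last knot
    is kept apart because its weight [tail N] does not vanish far from it. *)
Lemma spline_dist f N x (c eta : R) :
  (forall i, (i < N)%N -> `|f (knot i) - c| * (tail i x - tail i.+1 x) <=
     eta * (tail i x - tail i.+1 x)) ->
  `|spline f N x - c - (f (knot N) - c) * tail N x| <= eta * (1 - tail N x).
Proof.
elim: N => [|N IH] H.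
  by rewrite /spline big_geq//= /knot mul0r addr0 mulr1 !subrr normr0 mulr0.
have {}IH := IH (fun i iN => H i (ltnW iN)).
have HN := H N (ltnSn N).
rewrite /spline big_nat_recr//= -/(spline f N x).
set u := tail N x in IH HN *; set v := tail N.+1 x in HN *.
have uv : 0 <= u - v by rewrite subr_ge0; exact: tail_decr.
rewrite (_ : _ - _ - _ = (spline f N x - c - (f (knot N) - c) * u)
   + (f (knot N) - c) * (u - v)); last first.
  by rewrite /spline /v/=; ring.
apply: le_trans (ler_normD _ _) _; rewrite normrM (ger0_norm uv).
have -> : eta * (1 - v) = eta * (1 - u) + eta * (u - v) by ring.
exact: lerD.
Qed.

Lemma spline_norm f N x (K : R) : (forall y, 0 <= y -> `|f y| <= K) ->
  `|spline f N x| <= K.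
Proof.
move=> fK; have k0 i : 0 <= knot i by rewrite mulr_ge0// ltW.
have H : `|spline f N x - f (knot N) * tail N x| <= K * (1 - tail N x).
  have := @spline_dist f N x 0 K; rewrite !subr0; apply => i iN.
  by rewrite subr0 ler_wpM2r ?subr_ge0 ?tail_decr// fK.
have -> : spline f N x = (spline f N x - f (knot N) * tail N x) + f (knot N) * tail N x.
  by rewrite subrK.
apply: le_trans (ler_normD _ _) _.
have -> : K = K * (1 - tail N x) + K * tail N x by ring.
by rewrite lerD// normrM (ger0_norm (tail_ge0 _ _)) ler_wpM2r ?tail_ge0 ?fK.
Qed.

Lemma spline_approx f N x (K eta : R) : 0 <= x -> 0 <= eta ->
  (forall y, 0 <= y -> `|f y| <= K) ->
  (forall i, (i < N)%N -> `|x - knot i| < 2 * w -> `|f (knot i) - f x| <= eta) ->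
  `|f x - spline f N x| <= eta + 2 * K * tail N x.
Proof.
move=> x0 eta0 fK osc; have k0 i : 0 <= knot i by rewrite mulr_ge0// ltW.
have H : `|spline f N x - f x - (f (knot N) - f x) * tail N x| <= eta * (1 - tail N x).
  apply: spline_dist => i iN; case: (ltP `|x - knot i| (2 * w)) => h.
    by rewrite ler_wpM2r ?subr_ge0 ?tail_decr// osc.
  by rewrite (tail_weight0 _ _ x0 h) !mulr0.
have t0 := tail_ge0 N x; have t1 := tail_le1 N x.
rewrite distrC -(subrK ((f (knot N) - f x) * tail N x) (spline f N x - f x)).
apply: le_trans (ler_normD _ _) _; apply: lerD.
  by apply: le_trans H _; rewrite ler_piMr// lerBlDr lerDl.
rewrite normrM (ger0_norm t0) ler_wpM2r//.
apply: le_trans (ler_normB _ _) _; have := fK _ (k0 N); have := fK _ x0; lra.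
Qed.

Lemma knotS i : knot i.+1 - knot i = w.
Proof. by rewrite /knot -natr1; ring. Qed.

Lemma tail_lip i x y : `|tail i x - tail i y| <= w^-1 * `|x - y|.
Proof.
wlog xy : x y / x <= y.
  move=> H; case/orP: (le_total x y) => [|/H]; first exact: H.
  by rewrite distrC (distrC x).
rewrite distrC (distrC x) (ger0_norm (_ : 0 <= y - x)) ?subr_ge0//.
case: i => [|i] /=; first by rewrite subrr normr0 mulr_ge0 ?subr_ge0// invr_ge0 ltW.
have xy' : x / w - i%:R <= y / w - i%:R by rewrite lerD2r ler_pM2r ?invr_gt0.
have := sum_step_lip 1 _ _ xy'; rewrite big_nat1 !subr0.
rewrite ger0_norm ?subr_ge0 ?step_mono// => h; apply: le_trans h _.
by apply: eq_ler; ring.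
Qed.

Lemma tail_lipb i : exists K, lipb K (tail i).
Proof.
exists (1 + w^-1); have w1 : 0 < w^-1 by rewrite invr_gt0.
split=> [x|x y].
  by rewrite ger0_norm ?tail_ge0//; have := tail_le1 i x; lra.
by apply: le_trans (tail_lip i x y) _; rewrite ler_wpM2r//; lra.
Qed.

(** An increment of [f] between neighbouring knots is at most [w], and the steps,
    all nondecreasing, add up to a function of slope at most [1 / w]. *)
Lemma spline_lip f N x y : lipb 1 f -> `|spline f N x - spline f N y| <= `|x - y|.
Proof.
move=> fL; wlog xy : x y / x <= y.
  move=> H; case/orP: (le_total x y) => [|/H]; first exact: H.
  by rewrite distrC (distrC x).
rewrite distrC (distrC x) (ger0_norm (_ : 0 <= y - x)) ?subr_ge0//.
rewrite /spline opprD addrACA subrr add0r -sumrB.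
apply: le_trans (ler_norm_sum _ _ _) _.
have xyw : x / w <= y / w by rewrite ler_pM2r ?invr_gt0.
apply: (@le_trans _ _ (w * \sum_(0 <= i < N) (step (y / w - i%:R) - step (x / w - i%:R)))).
  rewrite mulr_sumr; apply: ler_sum => i _; rewrite -mulrBr normrM.
  have : 0 <= step (y / w - i%:R) - step (x / w - i%:R).
    by rewrite subr_ge0 step_mono// lerD2r.
  move=> h; rewrite (ger0_norm h) ler_wpM2r//.
  case: fL => _ /(_ (knot i.+1) (knot i)).
  by rewrite knotS mul1r (gtr0_norm w0).
have := sum_step_lip N _ _ xyw; rewrite -mulrBl => h.
by rewrite mulrC -ler_pdivlMr.
Qed.

Lemma spline'_norm f N x : lipb 1 f -> `|spline' f N x| <= 1.
Proof.
move=> fL; apply: le_trans (ler_norm_sum _ _ _) _.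
apply: le_trans (sum_step'_le1 N (x / w)).
apply: ler_sum => i _; rewrite normrM.
have h : 0 <= step' (x / w - i%:R) / w by rewrite divr_ge0 ?step'_ge0// ltW.
rewrite (ger0_norm h) mulrCA ler_piMr ?step'_ge0//.
rewrite ler_pdivrMr// mul1r.
case: fL => _ /(_ (knot i.+1) (knot i)).
by rewrite knotS mul1r (gtr0_norm w0).
Qed.

(** The second derivative is of order [1 / w], so it cannot be controlled by the
    Lipschitz constant of [f]; estimates on tame functions meant to be used here
    must not depend on [L]. *)
Lemma spline_tame f N : lipb 1 f -> exists L, tame L (spline f N) (spline' f N).
Proof.
move=> fL; pose D i := f (knot i.+1) - f (knot i).
pose S := \sum_(0 <= i < N) `|D i|.
have w1 : 0 < w^-1 by rewrite invr_gt0.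
exists (S * (4 * w^-1 ^+ 2)); split.
- split=> [x|x y]; last by rewrite mul1r spline_lip.
  by apply: spline_norm => y _; case: fL.
- by move=> x; exact: spline'_norm.
- move=> x y; rewrite /spline' -sumrB; apply: le_trans (ler_norm_sum _ _ _) _.
  rewrite -!mulrA mulr_suml; apply: ler_sum => i _.
  rewrite -mulrBr normrM ler_wpM2l// -mulrBl normrM (gtr0_norm w1).
  have := step'_lip (x / w - i%:R) (y / w - i%:R).
  rewrite opprB addrA subrK -mulrBl normrM (gtr0_norm w1) => h.
  apply: le_trans (ler_wpM2r (ltW w1) h) _.
  by apply: eq_ler; ring.
- move=> x y; rewrite /spline opprD addrACA subrr add0r -sumrB /spline' mulr_suml -sumrB.
  apply: le_trans (ler_norm_sum _ _ _) _.
  rewrite -!mulrA mulr_suml; apply: ler_sum => i _.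
  rewrite -mulrBr -mulrA -mulrBr normrM ler_wpM2l//=.
  have := step_taylor (x / w - i%:R) (y / w - i%:R).
  have -> : y / w - i%:R - (x / w - i%:R) = (y - x) / w by ring.
  move=> h; have -> : step' (x / w - i%:R) / w * (y - x) = step' (x / w - i%:R) * ((y - x) / w).
    by ring.
  apply: le_trans h _.
  by apply: eq_ler; ring.
- move=> x x0; rewrite /spline !big1// => i _ /=.
    by rewrite mul0r step_lo ?mulr0//; have : (0 : R) <= i%:R by []; lra.
  have : x / w <= 0 by rewrite pmulr_lle0.
  by move=> xw; rewrite step_lo ?mulr0//; have : (0 : R) <= i%:R by []; lra.
- move=> x x0; rewrite /spline' big1// => i _.
  rewrite step'_lo ?mul0r ?mulr0//.
  have : x / w <= 0 by rewrite pmulr_lle0.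
  have : (0 : R) <= i%:R by []. lra.
Qed.

Lemma spline_testable f N : testable (spline f N).
Proof.
rewrite /spline; elim: N => [|N IH].
  rewrite (_ : (fun _ => _) = fun=> f 0); first exact: testable_cst.
  by apply/funext => x; rewrite big_geq// addr0.
rewrite (_ : (fun _ => _) = fun x =>
    (f 0 + \sum_(0 <= i < N) (f (knot i.+1) - f (knot i)) * tail i.+1 x) +
    (f (knot N.+1) - f (knot N)) * tail N.+1 x).
  apply: testableD => //; apply: testableZ.
  by have [K /lipb_testable] := tail_lipb N.+1.
by apply/funext => x; rewrite big_nat_recr//= addrA.
Qed.

(** The spline is a combination of finitely many steps, whatever [f] is: this is
    how finitely many test functions control all of them at once. *)
Lemma pairing_spline_dist (mu nu : probR R) f N (K d : R) :
  on_Rplus mu -> on_Rplus nu ->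
  (forall y, 0 <= y -> `|f y| <= K) ->
  (forall i, (i < N)%N -> `|pairing mu (tail i.+1) - pairing nu (tail i.+1)| <= d) ->
  `|pairing mu (spline f N) - pairing nu (spline f N)| <= N%:R * (2 * K * d).
Proof.
move=> muR nuR fK; have k0 i : 0 <= knot i by rewrite mulr_ge0// ltW.
elim: N => [|N IH] H.
  have E rho : on_Rplus rho -> pairing rho (spline f 0) = f 0.
    move=> rR; rewrite -[RHS](pairing_cst rho)//; apply: eq_pairing => x _.
    by rewrite /spline big_geq// addr0.
  by rewrite !E// subrr normr0 mul0r.
have E rho : pairing rho (spline f N.+1) = pairing rho (spline f N) +
    (f (knot N.+1) - f (knot N)) * pairing rho (tail N.+1).
  have tt : testable (tail N.+1) by have [L /lipb_testable] := tail_lipb N.+1.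
  rewrite -pairingZ// -pairingD//; first last.
  - exact: testableZ.
  - exact: spline_testable.
  by apply: eq_pairing => x _; rewrite /spline big_nat_recr//= addrA.
rewrite !E opprD addrACA -mulrBr; apply: le_trans (ler_normD _ _) _.
have -> : N.+1%:R * (2 * K * d) = N%:R * (2 * K * d) + 2 * K * d.
  by rewrite -[N.+1%:R]natr1; ring.
apply: lerD.
  by apply: IH => i iN; apply: H; exact: ltnW.
rewrite normrM; apply: ler_pM => //; last exact: H.
by apply: le_trans (ler_normB _ _) _; have := fK _ (k0 N); have := fK _ (k0 N.+1); lra.
Qed.

Lemma pairing_spline_error (mu : probR R) f N (K eta : R) :
  on_Rplus mu -> testable f -> 0 <= eta ->
  (forall y, 0 <= y -> `|f y| <= K) ->
  (forall x i, 0 <= x -> (i < N)%N -> `|x - knot i| < 2 * w -> `|f (knot i) - f x| <= eta) ->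
  `|pairing mu f - pairing mu (spline f N)| <= eta + 2 * K * pairing mu (tail N).
Proof.
move=> muR tf eta0 fK osc.
have tt : testable (tail N) by have [L /lipb_testable] := tail_lipb N.
have -> : eta + 2 * K * pairing mu (tail N) =
    pairing mu (fun x => eta + 2 * K * tail N x).
  rewrite pairingD ?pairingZ ?pairing_cst//; first exact: testable_cst.
  exact: testableZ.
apply: pairing_dist_le => //; first exact: spline_testable.
  by apply: testableD; [exact: testable_cst|exact: testableZ].
by move=> x x0; apply: spline_approx => // i iN; exact: osc.
Qed.

Lemma tail_far N x : 0 <= x -> x / w + 1 < N%:R -> tail N x = 0.
Proof.
move=> x0; have y0 : 0 <= x / w by rewrite divr_ge0// ltW.
case: N => [|N] h; first by exfalso; lra.
by rewrite /= step_lo//; move: h; rewrite -[N.+1%:R]natr1; lra.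
Qed.

Lemma pairing_tail_cvg0 (mu : probR R) : on_Rplus mu ->
  pairing mu (tail N) @[N --> \oo] --> 0.
Proof.
move=> muR.
have mt N : measurable_fun (Rplus : set (measurableTypeR R)) (EFin \o tail N : measurableTypeR R -> _).
  by apply/measurable_EFinP; have [K /lipb_testable[]] := tail_lipb N.
have t0 : {ae mu, forall x, Rplus x ->
    (EFin \o tail N) x @[N --> \oo] --> cst 0%E x}.
  apply: aeW => x x0; apply: cvg_near_cst; near=> N.
  by rewrite /= tail_far//; near: N; exact: nbhs_infty_gtr.
have t1 : {ae mu, forall x N, Rplus x -> (`|(EFin \o tail N) x| <= cst 1%E x)%E}.
  by apply: aeW => x N _ /=; rewrite lee_fin ger0_norm ?tail_ge0// tail_le1.
have i1 : mu.-integrable Rplus (cst 1%E).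
  by apply: (testable_integrable mu (fun=> 1)); exact: testable_cst.
have [_ _] := @dominated_convergence _ _ _ mu _ measurable_Rplus
  (fun N => EFin \o tail N) (cst 0%E) (cst 1%E) mt (measurable_cst _)
  t0 i1 t1.
rewrite integral0 => /fine_cvgP[_]; exact.
Unshelve. all: by end_near. Qed.

End spline_approx.

(** * Weak convergence and the bounded Lipschitz distance *)

Section weak_convergence.
Context {R : realType}.
Implicit Types (f : R -> R) (mu nu : probR R) (gamma : nat -> probR R).

Lemma tail_small (w e : R) mu : 0 < w -> 0 < e -> on_Rplus mu ->
  \forall N \near \oo, pairing mu (tail w N) <= e.
Proof.
move=> w0 e0 muR; have := @pairing_tail_cvg0 _ w w0 mu muR.
move=> /cvgrPdist_le/(_ _ e0); apply: filterS => N.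
by rewrite sub0r normrN; exact: le_trans (ler_norm _).
Qed.

Lemma lipb_osc (w x : R) f i : lipb 1 f ->
  `|x - knot w i| < 2 * w -> `|f (knot w i) - f x| <= 2 * w.
Proof.
move=> [_ fL] h; apply: le_trans (fL _ _) _.
by rewrite mul1r distrC ltW.
Qed.

(** Interpolate [f] with a fine mesh, on a grid long enough for both measures to
    have little mass beyond it; the spline is tame. *)
Lemma tame_dist_lipb mu nu (d : R) : on_Rplus mu -> on_Rplus nu ->
  (forall L f f', tame L f f' -> `|pairing mu f - pairing nu f| <= d) ->
  forall f, lipb 1 f -> `|pairing mu f - pairing nu f| <= d.
Proof.
move=> muR nuR H f fL; apply/ler_addgt0Pr => e e0.
(* Each measure contributes an oscillation [2 * w] and a tail [2 * w]. *)
pose w := e / 8; have w0 : 0 < w by rewrite divr_gt0.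
near \oo => N.
have tf := lipb_testable _ _ fL.
have f1 y : 0 <= y -> `|f y| <= 1 by case: fL.
have w2 : 0 <= 2 * w by rewrite mulr_ge0// ltW.
have err (rho : probR R) : on_Rplus rho ->
    `|pairing rho f - pairing rho (spline w f N)| <= 2 * w + 2 * 1 * pairing rho (tail w N).
  move=> rR; apply: pairing_spline_error => // x i _ _; exact: lipb_osc.
have mN : pairing mu (tail w N) <= w by near: N; exact: tail_small.
have nN : pairing nu (tail w N) <= w by near: N; exact: tail_small.
have [L /H] := spline_tame w w0 f N fL.
have := err mu muR; have := err nu nuR.
rewrite [`|pairing nu f - _|]distrC => h1 h2 h3.
apply: le_trans (ler_distD (pairing mu (spline w f N)) _ _) _.
have : `|pairing mu (spline w f N) - pairing nu f| <=
   `|pairing mu (spline w f N) - pairing nu (spline w f N)| +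
   `|pairing nu (spline w f N) - pairing nu f| by exact: ler_distD.
move: mN nN h1 h2 h3; rewrite /w; lra.
Unshelve. all: by end_near. Qed.

(** Only the mass of [nu] far away appears on the right: the one of [mu] is
    recovered from it, [tail w N] being itself among the functions compared.  So
    the grid can be chosen from the limit measure alone. *)
Lemma spline_dist_bound (w d K eta : R) mu nu f N : 0 < w -> 0 <= eta ->
  on_Rplus mu -> on_Rplus nu -> testable f -> (forall y, 0 <= y -> `|f y| <= K) ->
  (forall x i, 0 <= x -> (i < N)%N -> `|x - knot w i| < 2 * w -> `|f (knot w i) - f x| <= eta) ->
  (forall i, (i < N.+1)%N -> `|pairing mu (tail w i) - pairing nu (tail w i)| <= d) ->
  `|pairing mu f - pairing nu f| <= 2 * eta + 4 * K * pairing nu (tail w N) +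
    (N%:R * (2 * K * d) + 2 * K * d).
Proof.
move=> w0 eta0 muR nuR tf fK osc td.
have K0 : 0 <= K by apply: le_trans (fK 0 _) => //.
have e1 := pairing_spline_error w w0 mu f N K eta muR tf eta0 fK osc.
have e2 := pairing_spline_error w w0 nu f N K eta nuR tf eta0 fK osc.
have e3 := pairing_spline_dist w w0 mu nu f N K d muR nuR fK (fun i iN => td i.+1 iN).
have e4 : K * pairing mu (tail w N) <= K * pairing nu (tail w N) + K * d.
  rewrite -mulrDr ler_wpM2l//; have := td N (ltnSn N).
  by rewrite ler_distl => /andP[_].
rewrite distrC in e2.
apply: le_trans (ler_distD (pairing mu (spline w f N)) _ _) _.
have : `|pairing mu (spline w f N) - pairing nu f| <=
   `|pairing mu (spline w f N) - pairing nu (spline w f N)| +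
   `|pairing nu (spline w f N) - pairing nu f| by exact: ler_distD.
lra.
Qed.

Lemma near_forall_lt (P : nat -> nat -> Prop) N :
  (forall i, \forall k \near \oo, P i k) ->
  \forall k \near \oo, forall i, (i < N)%N -> P i k.
Proof.
move=> H; elim: N => [|N IH]; first exact: nearW.
near=> k => i; rewrite ltnS leq_eqVlt => /predU1P[->|iN].
  by near: k; exact: H.
by move: i iN; near: k; exact: IH.
Unshelve. all: by end_near. Qed.

(** The grid and the mesh depend on [mu] and [e] only, so that weak convergence
    on finitely many steps suffices, uniformly in [f]. *)
Lemma weak_cvg_unif gamma mu : (\forall k \near \oo, on_Rplus (gamma k)) ->
  on_Rplus mu -> weak_cvg gamma mu ->
  forall e : R, 0 < e -> \forall k \near \oo, forall f, lipb 1 f ->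
    `|pairing (gamma k) f - pairing mu f| <= e.
Proof.
move=> gR muR gcvg e e0; (* The oscillation and the tail contribute [8 * w], the steps [2 * w]. *)
pose w := e / 16; have w0 : 0 < w by rewrite divr_gt0.
have [N mN] : exists N, pairing mu (tail w N) <= w.
  by near \oo => N; exists N; near: N; exact: tail_small.
pose d := w / (N%:R + 1); have N1 : 0 < N%:R + 1 :> R by rewrite ltr_wpDl.
have d0 : 0 < d by rewrite divr_gt0.
near=> k => f fL.
have w2 : 0 <= 2 * w by rewrite mulr_ge0// ltW.
have gkR : on_Rplus (gamma k) by near: k.
have tk : forall i, (i < N.+1)%N -> `|pairing (gamma k) (tail w i) - pairing mu (tail w i)| <= d.
  near: k; apply: near_forall_lt => i.
  have [K tK] := tail_lipb w w0 i.
  have /cvgrPdist_le/(_ _ d0) : pairing (gamma k) (tail w i) @[k --> \oo] --> pairing mu (tail w i).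
    apply: gcvg; first by apply: continuous_subspaceT; exact: lipb_continuous tK.
    exists K; split; first exact: num_real.
    by move=> M KM x _; case: tK => /(_ x)/le_trans + _; apply; exact: ltW.
  by apply: filterS => k; rewrite distrC.
have := spline_dist_bound w d 1 (2 * w) (gamma k) mu f N w0 w2 gkR muR
  (lipb_testable _ _ fL) (fun y _ => (proj1 fL) y) (fun x i _ _ => lipb_osc w x f i fL) tk.
move=> /le_trans; apply.
have -> : N%:R * (2 * 1 * d) + 2 * 1 * d = 2 * ((N%:R + 1) * d) by ring.
have -> : (N%:R + 1) * d = w by rewrite /d mulrCA divff ?mulr1// gt_eqF.
move: mN; rewrite /w; lra.
Unshelve. all: by end_near. Qed.

(** Heine--Cantor on a segment, except that the second point is free to leave it. *)
Lemma unif_continuous_segment f (M eta : R) : continuous f -> 0 < eta ->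
  \forall w \near 0^'+, forall x, 0 <= x <= M -> forall y, `|x - y| < 2 * w ->
    `|f x - f y| <= eta.
Proof.
move=> fc eta0.
have := @segment_compact R 0 M; rewrite compact_near_coveringP.
move=> /(_ _ (0^'+) (fun w x => forall y, `|x - y| < 2 * w -> `|f x - f y| <= eta) _) H.
have {}H : \forall w \near 0^'+, `[0, M]%classic `<=`
    (fun x => forall y, `|x - y| < 2 * w -> `|f x - f y| <= eta).
  apply: H => x _.
  have eta2 : 0 < eta / 2 by rewrite divr_gt0.
  have /cvgrPdist_lt/(_ _ eta2) := fc x.
  move=> /nbhs_ballP[r /= r0 fr].
  have frr t : `|x - t| < r -> `|f x - f t| < eta / 2 by move=> xt; exact: (fr t).
  near=> x' w => y yw /=.
  have xx' : `|x - x'| < r / 2.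
    near: x'; apply: (@cvgr_dist_lt _ _ _ _ _ id x); first exact: cvg_id.
    by rewrite divr_gt0.
  have wr : w < r / 4 by near: w; apply: nbhs_right_lt; rewrite divr_gt0.
  have h1 : `|f x - f x'| < eta / 2 by apply: frr; lra.
  have h2 : `|f x - f y| < eta / 2.
    by apply: frr; have := ler_distD x' x y; move: yw => /=; lra.
  have := ler_distD (f x) (f x') (f y); rewrite (distrC (f x') (f x)); lra.
apply: filterS H => w Hw x x0M y; apply: Hw.
by rewrite /= in_itv.
Unshelve. all: by end_near. Qed.

Lemma within_continuous_testable f : {within Rplus, continuous f} ->
  [bounded f x | x in Rplus] -> testable f.
Proof.
move=> fc [M [_ fM]]; split.
  exact: (subspace_continuous_measurable_fun measurable_Rplus fc).
by exists (M + 1) => x x0; apply: fM => //; rewrite ltrDl.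
Qed.

(** A function given on the half line only is extended by its value at 0. *)
Lemma within_continuous_ramp f : {within Rplus, continuous f} ->
  continuous (f \o ramp).
Proof.
move=> /subspace_continuousP fc x.
have rc : ramp y @[y --> x] --> ramp x.
  apply/cvgrPdist_lt => e e0; near=> y.
  apply: le_lt_trans (ramp_lip _ _) _.
  by near: y; apply: (@cvgr_dist_lt _ _ _ _ _ id x) => //; exact: cvg_id.
have r0 (y : R) : Rplus (ramp y) by rewrite /Rplus/=; case: (rampP y) => -[->].
move=> A /(fc _ (r0 x)) fA.
have rA : \forall y \near x, Rplus (ramp y) -> A (f (ramp y)) := rc _ fA.
change (\forall y \near x, A (f (ramp y))).
by apply: filterS rA => y; apply; exact: r0.
Unshelve. all: by end_near. Qed.

(** A grid of mesh [w] reaching beyond the grid of mesh 1 leaves less mass out.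
    This decouples the choice of the length of the grid, made first, from the
    choice of the mesh, which depends on it through the modulus of continuity. *)
Lemma tail_le_tail (w x : R) (N N0 : nat) : 0 < w -> 0 <= x ->
  N0%:R + 1 <= (N%:R - 1) * w -> tail w N x <= tail 1 N0 x.
Proof.
move=> w0 x0 NN0; case: (ltP (x / w + 1) N%:R) => h.
  by rewrite (tail_far w w0)// tail_ge0.
have xN : N0%:R + 1 <= x.
  by apply: le_trans NN0 _; rewrite -ler_pdivlMr//; lra.
suff -> : tail 1 N0 x = 1 by exact: tail_le1.
case: N0 xN {NN0} => [//|n]; rewrite -[n.+1%:R]natr1 /= divr1 => xn.
by rewrite step_hi//; lra.
Qed.

(** The steps are Lipschitz, so their integrals converge, and a bounded continuous
    function is close to a spline: fix a segment carrying most of the mass of [mu],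
    then a mesh from uniform continuity on that segment. *)
Lemma lipb_cvg_weak gamma mu : (\forall k \near \oo, on_Rplus (gamma k)) ->
  on_Rplus mu ->
  (forall e : R, 0 < e -> \forall k \near \oo, forall f, lipb 1 f ->
    `|pairing (gamma k) f - pairing mu f| <= e) ->
  weak_cvg gamma mu.
Proof.
move=> gR muR H f fc fb.
have tf := within_continuous_testable f fc fb.
have gc := within_continuous_ramp f fc.
have [K [K0 fK]] : exists K, 0 < K /\ forall x, 0 <= x -> `|f x| <= K.
  case: tf => _ [K fK]; exists (`|K| + 1); split; first by rewrite ltr_wpDl.
  by move=> x /fK/le_trans; apply; have := ler_norm K; lra.
have gE x : 0 <= x -> (f \o ramp) x = f x.
  by move=> x0; rewrite /= /ramp max_l.
apply/cvgrPdist_le => e e0.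
(* The error splits into tails, at most [4 * K * t], oscillation, [2 * eta], and
   steps, [2 * K * (N + 1) * d]. *)
pose t := e / (32 * K); have t0 : 0 < t by rewrite divr_gt0// mulr_gt0.
have [N0 mN0] : exists N, pairing mu (tail 1 N) <= t.
  by near \oo => N; exists N; near: N; exact: tail_small.
pose eta := e / 8; have eta0 : 0 < eta by rewrite divr_gt0.
have [w [w0 w1 wosc]] : exists w, [/\ 0 < w, w < 1 & forall x, 0 <= x <= N0%:R + 10 ->
    forall y, `|x - y| < 2 * w -> `|(f \o ramp) x - (f \o ramp) y| <= eta].
  near (0 : R)^'+ => w; exists w; split.
  - by near: w; exact: nbhs_right_gt.
  - by near: w; apply: nbhs_right_lt.
  - by near: w; exact: unif_continuous_segment.
(* The fine grid ends beyond [N0 + 1], where the steps of the coarse one are all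
   equal to 1, and before [N0 + 10], where uniform continuity is available. *)
pose N := (Num.truncn ((N0%:R + 3) / w)).+2.
have M0 : 0 <= (N0%:R + 3) / w by rewrite divr_ge0 ?(ltW w0)// addr_ge0.
have [NL NU] : N0%:R + 1 <= (N%:R - 1) * w /\ N%:R * w <= N0%:R + 10.
  have /andP[h1 h2] := truncn_itv M0.
  have NE : N%:R = (Num.truncn ((N0%:R + 3) / w))%:R + 2 :> R.
    by rewrite /N -addn2 natrD.
  rewrite -[X in _ < X]natr1 in h2; rewrite ler_pdivlMr// in h1.
  split; last by rewrite NE mulrDl; lra.
  rewrite -ler_pdivrMr// NE; apply: (@le_trans _ _ ((N0%:R + 3) / w)); last by lra.
  by rewrite ler_pM2r ?invr_gt0//; lra.
have mN : pairing mu (tail w N) <= t.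
  apply: le_trans mN0; apply: le_pairing.
  - by have [L tL] := tail_lipb w w0 N; exact: lipb_testable tL.
  - by have [L tL] := @tail_lipb R 1 ltr01 N0; exact: lipb_testable tL.
  - by move=> x x0; exact: tail_le_tail.
have osc x i : 0 <= x -> (i < N)%N -> `|x - knot w i| < 2 * w ->
    `|f (knot w i) - f x| <= eta.
  move=> x0 iN xi; have k0 : 0 <= knot w i by rewrite mulr_ge0// ltW.
  rewrite -(gE _ x0) -(gE _ k0); apply: wosc; last by rewrite distrC.
  rewrite k0/=; apply: le_trans NU; rewrite ler_pM2r// ler_nat; exact: ltnW.
have N1 : 0 < N%:R + 1 :> R by rewrite ltr_wpDl.
pose d := e / (16 * K * (N%:R + 1)).
have d0 : 0 < d by rewrite divr_gt0// !mulr_gt0.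
near=> k.
have gkR : on_Rplus (gamma k) by near: k.
have tk : forall i, (i < N.+1)%N -> `|pairing (gamma k) (tail w i) - pairing mu (tail w i)| <= d.
  near: k; apply: near_forall_lt => i.
  have [L tL] := tail_lipb w w0 i; have L0 := lipb_ge0 _ _ tL.
  have L1 : 0 < L + 1 by rewrite ltr_wpDl.
  have dL : 0 < d / (L + 1) by rewrite divr_gt0.
  apply: filterS (H _ dL) => k Hk.
  apply: le_trans (lipb_scale_dist L _ _ _ _ (ltW dL) Hk tL) _.
  rewrite mulrA ler_pdivrMr// mulrC ler_wpM2l ?(ltW d0)//; lra.
rewrite distrC.
have := spline_dist_bound w d K eta (gamma k) mu f N w0 (ltW eta0) gkR muR
  tf fK osc tk.
move=> /le_trans; apply.
have -> : N%:R * (2 * K * d) + 2 * K * d = e / 8.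
  rewrite /d; field.
  by rewrite ?gt_eqF.
have : 4 * K * pairing mu (tail w N) <= e / 8.
  apply: (@le_trans _ _ (4 * K * t)); first by rewrite ler_pM2l// mulr_gt0.
  by apply: eq_ler; rewrite /t; field; rewrite gt_eqF.
rewrite /eta; lra.
Unshelve. all: by end_near. Qed.

End weak_convergence.

(** * The continuous model over a short time *)

Section derivative_within_theory.
Context {R : realType}.
Implicit Types (F G f : R -> R).

Lemma derivative_within_near F (x l e : R) : derivative_within Rplus F x l ->
  0 < e -> exists2 r, 0 < r & forall y, 0 <= y -> `|x - y| < r ->
    `|F y - F x - l * (y - x)| <= e * `|y - x|.
Proof.
move=> /cvgrPdist_le H e0; have /nbhs_ballP[r /= r0 Hr] := H _ e0.
exists r => // y y0 xy; have [->|yx] := eqVneq y x.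
  by rewrite !subrr mulr0 subrr !normr0 mulr0.
have yx0 : y - x != 0 by rewrite subr_eq0.
have h := Hr y xy yx y0.
have -> : F y - F x - l * (y - x) = - ((l - (F y - F x) / (y - x)) * (y - x)).
  by rewrite mulrBl divfK// opprB.
by rewrite normrN normrM ler_wpM2r.
Qed.

Lemma derivative_within_continuous F G (u v : R) : 0 <= u ->
  (forall t, 0 <= t -> derivative_within Rplus F t (G t)) ->
  {within `[u, v], continuous F}.
Proof.
move=> u0 FG; apply/subspace_continuousP => x; rewrite /= in_itv /= => /andP[ux _].
have x0 : 0 <= x by exact: le_trans ux.
have [r r0 Hr] := derivative_within_near _ _ _ _ (FG x x0) ltr01.
pose K := `|G x| + 1; have K0 : 0 < K by rewrite ltr_wpDl.
apply/cvgrPdist_le => e e0; rewrite near_withinE; near=> y => /=.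
rewrite in_itv/= => /andP[uy _].
have xyr : `|x - y| < r by near: y; apply: (@cvgr_dist_lt _ _ _ _ _ id x) => //; exact: cvg_id.
have xye : `|x - y| < e / K.
  near: y; apply: (@cvgr_dist_lt _ _ _ _ _ id x); first exact: cvg_id.
  by rewrite divr_gt0.
have y0 : 0 <= y by exact: le_trans uy.
have h := Hr y y0 xyr.
have : `|F y - F x| <= K * `|y - x|.
  rewrite -(subrK (G x * (y - x)) (F y - F x)); apply: le_trans (ler_normD _ _) _.
  by rewrite /K mulrDl normrM addrC lerD.
rewrite distrC => /le_trans; apply; rewrite mulrC -ler_pdivlMr// distrC; exact: ltW.
Unshelve. all: by end_near. Qed.

Lemma derivative_within_is_derive F (x l : R) : 0 < x ->
  derivative_within Rplus F x l -> is_derive x 1 F l.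
Proof.
move=> x0 Fl.
have H : (fun h : R => h^-1 *: (F (h *: (1 : R) + x) - F x)) @ 0^' --> l.
  apply/cvgrPdist_le => e e0.
  have [r r0 Hr] := derivative_within_near _ _ _ _ Fl e0.
  near=> h.
  have h0 : h != 0 by near: h; exact: nbhs_dnbhs_neq.
  have hr : `|h| < Num.min r x.
    near: h; apply: dnbhs0_lt; by rewrite lt_min r0.
  move: hr; rewrite lt_min => /andP[hr hx].
  have hx0 : 0 <= h + x by move: hx; rewrite ltr_norml; lra.
  rewrite /GRing.scale/= mulr1.
  have := Hr (h + x) hx0; rewrite opprD addrCA subrr addr0 normrN => /(_ hr).
  rewrite addrK distrC -ler_pdivrMr ?normr_gt0// -normfV -normrM mulrBl mulfK//.
  by rewrite [_^-1 * _]mulrC.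
split; first by apply/cvg_ex; exists l.
exact: cvg_lim H.
Unshelve. all: by end_near. Qed.

Lemma derivative_within_MVT F G (u v : R) : 0 <= u -> u <= v ->
  (forall t, 0 <= t -> derivative_within Rplus F t (G t)) ->
  exists2 c, u <= c <= v & F v - F u = G c * (v - u).
Proof.
move=> u0 uv FG.
have [x|c] := @MVT_segment R F G u v uv _ (derivative_within_continuous F G u v u0 FG).
  rewrite in_itv/= => /andP[ux _]; have x0 : 0 < x by exact: le_lt_trans ux.
  by apply: derivative_within_is_derive => //; exact: FG (ltW x0).
by rewrite in_itv/= => uc E; exists c.
Qed.

Lemma tame_lipb' (L : R) f (f' : R -> R) : tame L f f' -> lipb (1 + `|L|) f'.
Proof.
move=> [fL f'1 f'L fT fn f'0].
split=> [x|x y]; first by apply: le_trans (f'1 x) _; rewrite lerDl.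
by apply: le_trans (f'L x y) _; rewrite ler_wpM2r//; have := ler_norm L; lra.
Qed.

Lemma tame_bC1star (L : R) f (f' : R -> R) : tame L f f' -> bC1star f f'.
Proof.
move=> ft; have f'b := tame_lipb' _ _ _ ft; case: ft => [fL _ _ fT _ f'0].
have bnd (K : R) (g : R -> R) : lipb K g -> [bounded g x | x in Rplus].
  move=> [gK _]; exists K; split; first exact: num_real.
  by move=> M KM x _; apply: le_trans (gK x) _; exact: ltW.
split.
- split; last exact: bnd fL.
  by apply: continuous_subspaceT; exact: lipb_continuous fL.
- move=> x x0; apply/cvgrPdist_le => e e0.
  have L1 : 0 < 1 + `|L| by rewrite ltr_pwDl.
  rewrite near_withinE; near=> y => y0.
  have yx : y != x by near: y; exact: nbhs_dnbhs_neq.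
  have yx0 : y - x != 0 by rewrite subr_eq0.
  have ye : `|y - x| < e / (1 + `|L|).
    near: y; apply/nbhs_ballP; exists (e / (1 + `|L|)) => /=; first by rewrite divr_gt0.
    by move=> y; rewrite /ball/= distrC.
  rewrite distrC -[f' x](mulfK yx0) -mulrBl normrM normfV ler_pdivrMr ?normr_gt0//.
  apply: le_trans (fT x y) _; rewrite -[(y - x) ^+ 2]ger0_norm ?sqr_ge0// normrX expr2.
  rewrite mulrA ler_wpM2r//; apply: (@le_trans _ _ ((1 + `|L|) * `|y - x|)).
    by rewrite ler_wpM2r//; have := ler_norm L; lra.
  by rewrite mulrC -ler_pdivlMr// ltW.
- split; last exact: bnd f'b.
  by apply: continuous_subspaceT; exact: lipb_continuous f'b.
- exact: f'0.
Unshelve. all: by end_near. Qed.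

Lemma tame_shift (L r : R) f (f' : R -> R) : 0 <= r -> tame L f f' ->
  tame L (fun x => f (x - r)) (fun x => f' (x - r)).
Proof.
move=> r0 [fL f'1 f'L fT fn f'0]; split.
- exact: lipb_shift.
- by move=> x; exact: f'1.
- by move=> x y; have := f'L (x - r) (y - r); rewrite opprB addrA subrK.
- by move=> x y; have := fT (x - r) (y - r); rewrite opprB addrA subrK.
- by move=> x x0; rewrite [LHS]fn ?[RHS]fn//; lra.
- by move=> x x0; apply: f'0; lra.
Qed.

End derivative_within_theory.

Lemma telescope_norm_le (R : realType) (X : nat -> R) (c : R) N :
  (forall j, (j < N)%N -> `|X j.+1 - X j| <= c) -> `|X N - X 0%N| <= N%:R * c.
Proof.
elim: N => [|N IH] H; first by rewrite subrr normr0 mul0r.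
apply: le_trans (ler_distD (X N) _ _) _.
have -> : N.+1%:R * c = c + N%:R * c by rewrite -[N.+1%:R]natr1; ring.
by apply: lerD; [exact: H|apply: IH => j jN; apply: H; exact: ltnW].
Qed.

Section CDR.
Context {R : realType}.
Variables (a m : R) (q : offspring R) (mu : R -> probR R).
Hypothesis a0 : 0 <= a.
Hypothesis mE : (\sum_(0 <= i <oo) (i%:R * q i)%:E = m%:E)%E.
Hypothesis muC : CDR_model a q mu.
Implicit Types (f : R -> R).

Let muR t : 0 <= t -> on_Rplus (mu t).
Proof. exact: (proj1 muC). Qed.

Lemma offspring_mean_ge0 : 0 <= m.
Proof.
rewrite -lee_fin -mE; apply: nneseries_ge0 => i _ _.
by rewrite lee_fin mulr_ge0// offspring_ge0.
Qed.

Definition generator t f (f' : R -> R) : R :=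
  a * (pairing (branch q (mu t)) f - pairing (mu t) f) - pairing (mu t) f'.

Lemma CDR_MVT (L u v : R) f (f' : R -> R) : tame L f f' -> 0 <= u -> u <= v ->
  exists2 c, u <= c <= v &
    pairing (mu v) f - pairing (mu u) f = generator c f f' * (v - u).
Proof.
move=> ft u0 uv.
apply: (@derivative_within_MVT R (fun s => pairing (mu s) f) (fun t => generator t f f')) => //.
move=> t t0; have := (proj2 muC) f f' (tame_bC1star _ _ _ ft) t t0.
congr (derivative_within _ _ _ (_ - _)).
apply: eq_pairing => x; rewrite le_eqVlt => /predU1P[<-|x0].
  by rewrite (tame_neg' _ _ _ ft)// mul0r.
by rewrite indicE mem_set// mulr1.
Qed.

(** The equation bounds the time derivative by [2 * a + 1] on tame functions, whose
    derivative is at most 1; [tame_dist_lipb] passes to all Lipschitz functions. *)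
Lemma CDR_time_lip (u v : R) f : 0 <= u -> u <= v -> lipb 1 f ->
  `|pairing (mu v) f - pairing (mu u) f| <= (2 * a + 1) * (v - u).
Proof.
move=> u0 uv; have v0 := le_trans u0 uv.
apply: tame_dist_lipb; [exact: muR|exact: muR|].
move=> L g g' gt; have [c /andP[uc cv] ->] := CDR_MVT _ _ _ _ _ gt u0 uv.
have c0 := le_trans u0 uc.
rewrite normrM [`|v - u|]ger0_norm ?subr_ge0// ler_wpM2r ?subr_ge0//.
have gL := tame_lipb _ _ _ gt; have g'L := tame_lipb' _ _ _ gt.
have tg := lipb_testable _ _ gL; have tg' := lipb_testable _ _ g'L.
have h1 : `|pairing (branch q (mu c)) g| <= 1.
  apply: pairing_norm_le => //; last by move=> x _; case: gL.
  by apply: branch_on_Rplus; exact: muR.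
have h2 : `|pairing (mu c) g| <= 1.
  by apply: pairing_norm_le => //; [exact: muR|move=> x _; case: gL].
have h3 : `|pairing (mu c) g'| <= 1.
  apply: pairing_norm_le => //; [exact: muR|move=> x _]; exact: tame_bound' gt _.
rewrite /generator; apply: le_trans (ler_normB _ _) _; apply: lerD => //.
rewrite normrM (ger0_norm a0) mulrC ler_wpM2r//.
apply: le_trans (ler_normB _ _) _; lra.
Qed.

(* The speed of [mu] in the bounded Lipschitz distance. *)
Let M := 2 * a + 1.

Let M0 : 0 <= M. Proof. by rewrite addr_ge0// mulr_ge0. Qed.

Lemma CDR_branch_time_lip (u v : R) f : 0 <= u -> u <= v -> lipb 1 f ->
  `|pairing (branch q (mu v)) f - pairing (branch q (mu u)) f| <=
  (1 + m) * (M * (v - u)).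
Proof.
move=> u0 uv; apply: pairing_branch_dist => //.
- by rewrite mulr_ge0// subr_ge0.
- by apply: muR; exact: le_trans uv.
- exact: muR.
- by move=> g gL; exact: CDR_time_lip.
Qed.

(** Mean value theorem and Taylor expansion.  The dependence on [L] comes from
    comparing the transport terms [f'] at two times, and from the second order
    term of the translation. *)
Lemma CDR_step_rough (L t h : R) f (f' : R -> R) : tame L f f' -> 0 <= t -> 0 <= h ->
  `|pairing (mu (t + h)) f - pairing (mu t) (fun x => f (x - h))
    - a * h * (pairing (branch q (mu t)) f - pairing (mu t) f)| <=
  (a * ((2 + m) * M) + (1 + `|L|) * M + `|L|) * h ^+ 2.
Proof.
move=> ft t0 h0; have tth : t <= t + h by rewrite lerDl.
have [c /andP[tc cth]] := CDR_MVT _ _ _ _ _ ft t0 tth.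
rewrite (addrC t h) addrK (addrC h t) => E.
have c0 := le_trans t0 tc.
have fL := tame_lipb _ _ _ ft; have f'L := tame_lipb' _ _ _ ft.
have tf := lipb_testable _ _ fL; have tf' := lipb_testable _ _ f'L.
have ch : c - t <= h by lra.
have ct0 : 0 <= c - t by lra.
have m0 := offspring_mean_ge0.
have Mch : M * (c - t) <= M * h by rewrite ler_wpM2l.
(* [e1], [e2], [e3] freeze the generator at time [t] instead of [c]; [e4] replaces
   its transport term by the translation. *)
have e1 : `|pairing (branch q (mu c)) f - pairing (branch q (mu t)) f| <= (1 + m) * (M * h).
  apply: le_trans (CDR_branch_time_lip _ _ _ t0 tc fL) _.
  by rewrite ler_wpM2l//; lra.
have e2 : `|pairing (mu c) f - pairing (mu t) f| <= M * h.
  exact: le_trans (CDR_time_lip _ _ _ t0 tc fL) _.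
have e3 : `|pairing (mu c) f' - pairing (mu t) f'| <= (1 + `|L|) * (M * h).
  apply: (lipb_scale_dist _ _ _ _ _ _ _ f'L); first by rewrite mulr_ge0.
  by move=> g gL; exact: le_trans (CDR_time_lip _ _ _ t0 tc gL) _.
have e4 : `|pairing (mu t) (fun x => f (x - h)) - (pairing (mu t) f - h * pairing (mu t) f')| <= `|L| * h ^+ 2.
  rewrite -pairingZ// -pairingB//; last exact: testableZ.
  apply: pairing_dist_le_cst; first exact: muR.
  - exact: lipb_testable (lipb_shift _ _ (- h) fL).
  - by apply: testableB => //; exact: testableZ.
  - move=> x _; have := tame_taylor _ _ _ ft x (x - h).
    have -> : x - h - x = - h by ring.
    rewrite sqrrN => H.
    have -> : f (x - h) - (f x - h * f' x) = f (x - h) - f x - f' x * - h by ring.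
    by apply: le_trans H _; rewrite ler_wpM2r ?sqr_ge0// ler_norm.
have -> : pairing (mu (t + h)) f - pairing (mu t) (fun x => f (x - h))
    - a * h * (pairing (branch q (mu t)) f - pairing (mu t) f) =
  h * (a * ((pairing (branch q (mu c)) f - pairing (branch q (mu t)) f)
            - (pairing (mu c) f - pairing (mu t) f))
       - (pairing (mu c) f' - pairing (mu t) f'))
  - (pairing (mu t) (fun x => f (x - h)) - (pairing (mu t) f - h * pairing (mu t) f')).
  have -> : pairing (mu (t + h)) f = generator c f f' * h + pairing (mu t) f by rewrite -E subrK.
  by rewrite /generator; ring.
have -> : (a * ((2 + m) * M) + (1 + `|L|) * M + `|L|) * h ^+ 2 =
   h * (a * ((1 + m) * (M * h) + M * h) + (1 + `|L|) * (M * h)) + `|L| * h ^+ 2 by ring.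
apply: le_trans (ler_normB _ _) _; apply: lerD => //.
rewrite normrM (ger0_norm h0) ler_wpM2l//.
apply: le_trans (ler_normB _ _) _; apply: lerD => //.
rewrite normrM (ger0_norm a0) ler_wpM2l//.
by apply: le_trans (ler_normB _ _) _; apply: lerD.
Qed.

(** Along [s |-> <mu_(t+s), f (. - (h - s))>] the transport terms cancel, leaving
    the branching term, which varies by O(h) over the interval with a constant
    free of [L].  The increments are computed by [CDR_step_rough] on [N] pieces
    of length [h / N], where the part depending on [L] adds up to O(h^2 / N). *)
Lemma CDR_step (L t h : R) f (f' : R -> R) : tame L f f' -> 0 <= t -> 0 <= h ->
  `|pairing (mu (t + h)) f - pairing (mu t) (fun x => f (x - h))
    - a * h * (pairing (branch q (mu t)) (fun x => f (x - h))
               - pairing (mu t) (fun x => f (x - h)))| <=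
  a * ((2 + m) * M + 2) * h ^+ 2.
Proof.
move=> ft t0 h0; have m0 := offspring_mean_ge0.
pose C := a * ((2 + m) * M) + (1 + `|L|) * M + `|L|.
have C0 : 0 <= C by rewrite !addr_ge0// !mulr_ge0// !addr_ge0.
apply/ler_addgt0Pr => e e0.
(* So many pieces that the part depending on [L], [C * h ^+ 2 / N], is below [e]. *)
pose N := (Num.truncn (C * h ^+ 2 / e)).+1.
have N0 : 0 < N%:R :> R by rewrite ltr0n.
have Ne : C * h ^+ 2 / N%:R <= e.
  rewrite ler_pdivrMr// [e * _]mulrC -ler_pdivrMr//; apply: ltW.
  have Ce : 0 <= C * h ^+ 2 / e by rewrite divr_ge0 ?(ltW e0)// mulr_ge0// sqr_ge0.
  by case/andP: (truncn_itv Ce).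
pose d := h / N%:R; have d0 : 0 <= d by rewrite divr_ge0// ltW.
have Nd : N%:R * d = h by rewrite /d mulrCA divff ?mulr1// gt_eqF.
(* [X] goes from the translated initial value, at 0, to the solution less the
   frozen branching term, at [N]. *)
pose F j := fun x => f (x - (h - j%:R * d)).
pose F' j := fun x => f' (x - (h - j%:R * d)).
pose K0 := pairing (branch q (mu t)) (F 0%N) - pairing (mu t) (F 0%N).
pose X j := pairing (mu (t + j%:R * d)) (F j) - a * (j%:R * d) * K0.
have F0 : F 0%N = (fun x => f (x - h)).
  by apply/funext => x; rewrite /F mul0r subr0.
have FN : F N = f by apply/funext => x; rewrite /F Nd subrr subr0.
have X0 : X 0%N = pairing (mu t) (fun x => f (x - h)).
  by rewrite /X mul0r addr0 mulr0 mul0r subr0 F0.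
have XN : X N = pairing (mu (t + h)) f - a * h * K0 by rewrite /X Nd FN.
suff XX j : (j < N)%N -> `|X j.+1 - X j| <= d * (a * ((2 + m) * M + 2) * h) + C * d ^+ 2.
  have := telescope_norm_le _ _ _ _ XX.
  rewrite XN X0 /K0 F0 => H; rewrite addrAC; apply: le_trans H _.
  rewrite mulrDr; apply: lerD.
    have -> : N%:R * (d * (a * ((2 + m) * M + 2) * h)) =
        (N%:R * d) * (a * ((2 + m) * M + 2) * h) by ring.
    by rewrite Nd le_eqVlt; apply/orP; left; apply/eqP; ring.
  apply: le_trans Ne.
  by apply: eq_ler; rewrite /d; field; rewrite gt_eqF.
move=> jN.
have jd0 : 0 <= j%:R * d by rewrite mulr_ge0.
have jdh : j.+1%:R * d <= h by rewrite -Nd ler_wpM2r// ler_nat.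
have jS : j.+1%:R * d = j%:R * d + d by rewrite -[j.+1%:R]natr1; ring.
have jdh' : j%:R * d <= h by rewrite jS in jdh; lra.
have tj : 0 <= t + j%:R * d by rewrite addr_ge0.
have ttj : t <= t + j%:R * d by rewrite lerDl.
have FT i : i%:R * d <= h -> tame L (F i) (F' i).
  by move=> ih; apply: tame_shift => //; rewrite subr_ge0.
have F1 := FT _ jdh; have FL1 := tame_lipb _ _ _ F1.
have h0d : 0%:R * d <= h by rewrite mul0r.
have FL0 := tame_lipb _ _ _ (FT 0%N h0d).
have FF x : `|F j.+1 x - F 0%N x| <= h.
  apply: le_trans (proj2 (tame_lipb _ _ _ ft) _ _) _; rewrite mul1r mul0r subr0.
  have -> : x - (h - j.+1%:R * d) - (x - h) = j.+1%:R * d by ring.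
  by rewrite ger0_norm// mulr_ge0.
have step := CDR_step_rough L (t + j%:R * d) d _ _ F1 tj d0.
have tE : t + j%:R * d + d = t + j.+1%:R * d by rewrite jS addrA.
rewrite tE in step.
have sF : (fun x => F j.+1 (x - d)) = F j.
  by apply/funext => x; rewrite /F jS; congr f; ring.
rewrite sF -/C in step.
have Mjd : M * (t + j%:R * d - t) <= M * h by rewrite ler_wpM2l//; lra.
(* Freezing the branching term moves the time by [j * d] and the translate by
   [j.+1 * d], both at most [h]. *)
have b1 : `|pairing (branch q (mu (t + j%:R * d))) (F j.+1) - pairing (branch q (mu t)) (F 0%N)| <= (1 + m) * (M * h) + h.
  apply: le_trans (ler_distD (pairing (branch q (mu t)) (F j.+1)) _ _) _; apply: lerD.
    apply: le_trans (CDR_branch_time_lip _ _ _ t0 ttj FL1) _.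
    by rewrite ler_wpM2l//; lra.
  apply: pairing_dist_le_cst => //; first by apply: branch_on_Rplus; exact: muR.
  - exact: lipb_testable FL1.
  - exact: lipb_testable FL0.
have b2 : `|pairing (mu (t + j%:R * d)) (F j.+1) - pairing (mu t) (F 0%N)| <= M * h + h.
  apply: le_trans (ler_distD (pairing (mu t) (F j.+1)) _ _) _; apply: lerD.
    exact: le_trans (CDR_time_lip _ _ _ t0 ttj FL1) _.
  apply: pairing_dist_le_cst => //; first exact: muR.
  - exact: lipb_testable FL1.
  - exact: lipb_testable FL0.
set P := pairing (branch q (mu (t + j%:R * d))) (F j.+1) in step b1.
set Q := pairing (mu (t + j%:R * d)) (F j.+1) in step b2.
have -> : X j.+1 - X j = a * d * ((P - pairing (branch q (mu t)) (F 0%N)) - (Q - pairing (mu t) (F 0%N)))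
  + (pairing (mu (t + j.+1%:R * d)) (F j.+1) - pairing (mu (t + j%:R * d)) (F j) - a * d * (P - Q)).
  by rewrite /X /K0 jS; ring.
apply: le_trans (ler_normD _ _) _; apply: lerD => //.
have -> : d * (a * ((2 + m) * M + 2) * h) = a * d * (((1 + m) * (M * h) + h) + (M * h + h)) by ring.
have ad : 0 <= a * d by rewrite mulr_ge0.
rewrite normrM (ger0_norm ad) ler_wpM2l//.
by apply: le_trans (ler_normB _ _) _; apply: lerD.
Qed.

End CDR.

(** * Convergence of the scheme *)

Section scheme.
Context {R : realType}.
Variables (a m : R) (q : offspring R) (mu : R -> probR R).
Hypothesis a0 : 0 <= a.
Hypothesis mE : (\sum_(0 <= i <oo) (i%:R * q i)%:E = m%:E)%E.
Hypothesis muC : CDR_model a q mu.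
Implicit Types (f : R -> R).

(** The truncated shift by 1 becomes the shift by [1 / k] after rescaling, a plain
    translation of the tame function. *)
Lemma rescaled_DR_step (L : R) (k : nat) (nu : nat -> probR R) n f (f' : R -> R) :
  (1 <= k)%N -> DR_model (a / k%:R) q nu -> tame L f f' ->
  let g x := f (x - k%:R^-1) in
  pairing (rescale k (nu n.+1)) f =
  (1 - a / k%:R) * pairing (rescale k (nu n)) g +
  a / k%:R * pairing (branch q (rescale k (nu n))) g.
Proof.
move=> k1 nuDR ft g; have [_ nuR _] := nuDR.
have fL := tame_lipb _ _ _ ft.
have gL : lipb 1 g by exact: lipb_shift.
have k0 : 0 < k%:R :> R by rewrite ltr0n.
rewrite (pairing_rescale 1 k (nu n.+1) f k1 (nuR _) fL).
rewrite (pairing_DR_step _ _ _ _ n _ nuDR (lipb_div _ _ _ k1 fL)).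
have shE (x : R) : f (shift_pos 1 x / k%:R) = g (x / k%:R).
  rewrite /g /shift_pos; have -> : x / k%:R - k%:R^-1 = (x - 1) / k%:R.
    by rewrite mulrBl mul1r.
  rewrite maxEle; case: ifPn => // x1.
  by rewrite mul0r [RHS](tame_neg _ _ _ ft)// pmulr_lle0// invr_gt0.
rewrite (pairing_rescale 1 k (nu n) g k1 (nuR _) gL).
rewrite (pairing_branch_rescale q m 1 k (nu n) g mE k1 (nuR _) gL).
congr (_ * _ + _ * _); apply: eq_pairing => x _; exact: shE.
Qed.

(* The constant of [CDR_step]. *)
Let C := a * ((2 + m) * (2 * a + 1) + 2).

(** Discrete Gronwall inequality.  The induction hypothesis is used on all [lipb 1]
    functions, through [branch]; the step is proved on tame ones and extended by
    [tame_dist_lipb], at no loss in the constants, so that the recursion closes. *)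
Lemma scheme_error (k : nat) (nu : nat -> probR R) (e : R) n :
  (1 <= k)%N -> a <= k%:R -> DR_model (a / k%:R) q nu -> 0 <= e ->
  (forall f, lipb 1 f ->
     `|pairing (rescale k (nu 0%N)) f - pairing (mu 0) f| <= e) ->
  forall f, lipb 1 f ->
  `|pairing (rescale k (nu n)) f - pairing (mu (n%:R / k%:R)) f| <=
    (1 + a * (1 + m) / k%:R) ^+ n * (e + n%:R * (C * k%:R^-1 ^+ 2)).
Proof.
move=> k1 ak nuDR e0 H0; have m0 : 0 <= m by exact: offspring_mean_ge0 mE.
have [_ nuR _] := nuDR.
have k0 : 0 < k%:R :> R by rewrite ltr0n.
have h0 : 0 <= k%:R^-1 :> R by rewrite invr_ge0 ltW.
have ah0 : 0 <= a / k%:R by rewrite mulr_ge0.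
have ah1 : 0 <= 1 - a / k%:R by rewrite subr_ge0 ler_pdivrMr// mul1r.
have C0 : 0 <= C by rewrite mulr_ge0// addr_ge0// mulr_ge0 ?addr_ge0// mulr_ge0.
pose B := 1 + a * (1 + m) / k%:R.
have B1 : 1 <= B by rewrite lerDl mulr_ge0// mulr_ge0// addr_ge0.
have Ch0 : 0 <= C * k%:R^-1 ^+ 2 by rewrite mulr_ge0// sqr_ge0.
elim: n => [|n IH]; first by move=> f fL; rewrite expr0 !mul0r addr0 mul1r; exact: H0.
set D := _ ^+ n * _ in IH.
have D0 : 0 <= D.
  apply: mulr_ge0; last by rewrite addr_ge0// mulr_ge0.
  by rewrite exprn_ge0// -/B (le_trans ler01).
have nk0 : 0 <= n%:R / k%:R :> R by rewrite mulr_ge0.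
have nSk0 : 0 <= n.+1%:R / k%:R :> R by rewrite mulr_ge0.
have nSE : n%:R / k%:R + k%:R^-1 = n.+1%:R / k%:R :> R.
  by rewrite -[n.+1%:R]natr1 mulrDl mul1r.
have muR t : 0 <= t -> on_Rplus (mu t) by exact: (proj1 muC).
have gR i : on_Rplus (rescale k (nu i)) by exact: rescale_on_Rplus.
suff tameH L f f' : tame L f f' ->
    `|pairing (rescale k (nu n.+1)) f - pairing (mu (n.+1%:R / k%:R)) f| <=
    B * D + C * k%:R^-1 ^+ 2.
  move=> f fL; apply: le_trans (tame_dist_lipb _ _ _ (gR _) (muR _ nSk0) tameH _ fL) _.
  have -> : B ^+ n.+1 * (e + n.+1%:R * (C * k%:R^-1 ^+ 2)) =
      B * D + B ^+ n.+1 * (C * k%:R^-1 ^+ 2).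
    by rewrite /D -/B exprS -[n.+1%:R]natr1; ring.
  by rewrite lerD2l ler_peMl// exprn_ege1.
move=> ft; have fL := tame_lipb _ _ _ ft.
rewrite (rescaled_DR_step _ _ _ _ _ _ k1 nuDR ft).
have := CDR_step a m q mu a0 mE muC L _ _ _ _ ft nk0 h0.
rewrite nSE -/C; set g := fun x => f (x - k%:R^-1) => step.
have gL : lipb 1 g by exact: lipb_shift.
have e1 : `|pairing (rescale k (nu n)) g - pairing (mu (n%:R / k%:R)) g| <= D by exact: IH.
have e2 : `|pairing (branch q (rescale k (nu n))) g - pairing (branch q (mu (n%:R / k%:R))) g| <= (1 + m) * D.
  by apply: pairing_branch_dist => //; exact: muR.
set p1 := pairing (rescale k (nu n)) g in e1 *.
set p2 := pairing (branch q (rescale k (nu n))) g in e2 *.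
set r1 := pairing (mu (n%:R / k%:R)) g in step e1 *.
set r2 := pairing (branch q (mu (n%:R / k%:R))) g in step e2 *.
set r3 := pairing (mu (n.+1%:R / k%:R)) f in step *.
have -> : (1 - a / k%:R) * p1 + a / k%:R * p2 - r3 =
  (1 - a / k%:R) * (p1 - r1) + a / k%:R * (p2 - r2) - (r3 - r1 - a / k%:R * (r2 - r1)) by ring.
apply: le_trans (ler_normB _ _) _; apply: lerD => //.
apply: le_trans (ler_normD _ _) _.
rewrite (normrM (1 - a / k%:R)) (normrM (a / k%:R)) (ger0_norm ah0) (ger0_norm ah1).
apply: (@le_trans _ _ ((1 - a / k%:R) * D + a / k%:R * ((1 + m) * D))).
  by apply: lerD; rewrite ler_wpM2l.
have -> : B * D = 1 * D + a / k%:R * ((1 + m) * D) by rewrite /B; ring.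
by rewrite lerD2r ler_wpM2r// lerBlDr lerDl.
Qed.

Lemma growth_bound (c t : R) (k n : nat) : 0 <= c -> (1 <= k)%N ->
  n%:R <= k%:R * t -> (1 + c / k%:R) ^+ n <= expR (c * t).
Proof.
move=> c0 k1 nt; have k0 : 0 < k%:R :> R by rewrite ltr0n.
have ck : 0 <= c / k%:R by rewrite divr_ge0// ltW.
apply: (@le_trans _ _ (expR (c / k%:R) ^+ n)).
  by apply: lerXn2r; rewrite ?nnegrE ?expR_ge0 ?addr_ge0 ?expR_ge1Dx.
rewrite -expRM_natl ler_expR.
have -> : n%:R * (c / k%:R) = c * (n%:R / k%:R) by ring.
by rewrite ler_wpM2l// ler_pdivrMr// mulrC.
Qed.

End scheme.

Theorem theorem2p8 (R : realType) (a : R) (q : offspring R)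
  (mu : R -> probR R) (nu : nat -> nat -> probR R)
  (a_ge0 : 0 <= a)
  (m1_fin : (\sum_(1 <= i <oo) (i%:R * q i)%:E < +oo)%E)
  (mu_CDR : CDR_model a q mu)
  (nu_DR : forall k : nat, (1 <= k)%N -> a <= k%:R ->
     DR_model (a / k%:R) q (nu k))
  (cvg0 : weak_cvg (fun k => rescale k (nu k 0%N)) (mu 0)) :
  forall t : R, 0 <= t ->
    weak_cvg (fun k => rescale k (nu k (Num.truncn (k%:R * t)))) (mu t).
Proof.
move=> t t0.
have q0 i : (0 <= (i%:R * q i)%:E)%E by rewrite lee_fin mulr_ge0// offspring_ge0.
have [m mE] : exists m, (\sum_(0 <= i <oo) (i%:R * q i)%:E = m%:E)%E.
  rewrite (nneseries_split 0 1)// add0n big_nat1 mul0r add0e.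
  exists (fine (\sum_(1 <= i <oo) (i%:R * q i)%:E)%E).
  by rewrite fineK// ge0_fin_numE// nneseries_ge0.
have m0 : 0 <= m by exact: offspring_mean_ge0 mE.
have muR s : 0 <= s -> on_Rplus (mu s) by exact: (proj1 mu_CDR).
have large : \forall k \near \oo, (1 <= k)%N /\ a <= k%:R.
  near=> k; split; first by near: k; exact: nbhs_infty_ge.
  by near: k; exact: nbhs_infty_ger.
have gR (n : nat -> nat) : \forall k \near \oo, on_Rplus (rescale k (nu k (n k))).
  apply: filterS large => k [k1 ak]; have [_ nuR _] := nu_DR k k1 ak.
  exact: rescale_on_Rplus.
apply: lipb_cvg_weak; [exact: gR|exact: muR|] => e e0.
pose E := expR (a * (1 + m) * t); have E0 : 0 < E by exact: expR_gt0.
pose C := a * ((2 + m) * (2 * a + 1) + 2).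
have C0 : 0 <= C by rewrite mulr_ge0// addr_ge0// mulr_ge0 ?addr_ge0// mulr_ge0.
pose d := e / (4 * E); have d0 : 0 < d by rewrite divr_gt0// mulr_gt0.
near=> k => f fL.
have [k1 ak] : (1 <= k)%N /\ a <= k%:R by near: k.
have k0 : 0 < k%:R :> R by rewrite ltr0n.
have init : forall f, lipb 1 f -> `|pairing (rescale k (nu k 0%N)) f - pairing (mu 0) f| <= d.
  near: k; apply: (weak_cvg_unif _ _ (gR (fun=> 0%N)) (muR 0 (lexx 0)) cvg0 d d0).
have kC : C * t / d <= k%:R by near: k; exact: nbhs_infty_ger.
have kM : (2 * a + 1) / (e / 2) <= k%:R by near: k; exact: nbhs_infty_ger.
set n := Num.truncn (k%:R * t).
have kt0 : 0 <= k%:R * t by rewrite mulr_ge0// ltW.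
have /andP[nt tn] := truncn_itv kt0; rewrite -/n in nt tn.
have nk0 : 0 <= n%:R / k%:R :> R by rewrite divr_ge0// ltW.
have nkt : n%:R / k%:R <= t by rewrite ler_pdivrMr// mulrC.
have tnk : t - n%:R / k%:R <= k%:R^-1.
  rewrite lerBlDr -[X in X + _]mul1r -mulrDl ler_pdivlMr// mulrC addrC natr1.
  exact: ltW.
apply: le_trans (ler_distD (pairing (mu (n%:R / k%:R)) f) _ _) _.
(* The scheme is compared with the solution at the grid time [n / k], which is
   within [1 / k] of [t]. *)
have -> : e = e / 2 + e / 2 by lra.
apply: lerD.
  have := scheme_error a m q mu a_ge0 mE mu_CDR k (nu k) d n k1 ak
    (nu_DR k k1 ak) (ltW d0) init f fL.
  move=> /le_trans; apply.
  have -> : e / 2 = E * (d + d) by rewrite /d; field; rewrite gt_eqF.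
  apply: ler_pM.
  - by rewrite exprn_ge0// addr_ge0// divr_ge0 ?(ltW k0)// mulr_ge0// addr_ge0.
  - by apply: addr_ge0; [exact: ltW|apply: mulr_ge0 => //; rewrite mulr_ge0// sqr_ge0].
  - by apply: growth_bound => //; rewrite mulr_ge0// addr_ge0.
  - rewrite lerD2l -/C.
    have -> : n%:R * (C * k%:R^-1 ^+ 2) = (C * (n%:R / k%:R)) / k%:R by ring.
    rewrite ler_pdivrMr// [d * _]mulrC.
    apply: (@le_trans _ _ (C * t)); first by rewrite ler_wpM2l.
    by rewrite -ler_pdivrMr.
rewrite distrC; apply: le_trans (CDR_time_lip a q mu a_ge0 mu_CDR _ _ _ nk0 nkt fL) _.
apply: (@le_trans _ _ ((2 * a + 1) * k%:R^-1)).
  by rewrite ler_wpM2l// addr_ge0// mulr_ge0.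
rewrite ler_pdivrMr// [_ * k%:R]mulrC -ler_pdivrMr ?divr_gt0//.
Unshelve. all: by end_near. Qed.
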